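(* Let $d\ge 3$. If $c\in(\mathbb{C}^* )^{d(d-1)/2}$ is a scaling whose scaling matrix $C\in\mathbb{C}^{d\times d}$ has rank three, then the ML degree of the scaled toric variety $V_d^c$ is $$\operatorname{MLdeg}(V_d^c)=\binom{d-1}{2}.$$ In particular, there exists a scaling $c\in(\mathbb{C}^* )^{d(d-1)/2}$ for which this ML degree is realized.
   Context: A scaling is a vector $c=(c_{ij})_{1\le i<j\le d}\in(\mathbb{C}^* )^{d(d-1)/2}$. Put $n=d(d-1)/2$ and index the homogeneous coordinates of $\mathbb{CP}^{n-1}$ by pairs $1\le i<j\le d$, which correspond to the lattice points $e_i+e_j$ of the second hypersimplex $\Delta_{d,2}=\{x\in[0,1]^d\mid x_1+\dots+x_d=2\}$. The scaled toric variety $V_d^c\subseteq\mathbb{CP}^{n-1}$ is the Zariski closure of the image of $(\mathbb{C}^* )^d\to\mathbb{CP}^{n-1}$, $(\theta_1,\dots,\theta_d)\mapsto[c_{ij}\theta_i\theta_j]_{1\le i<j\le d}$. The scaling matrix of $V_d^c$ is the symmetric matrix $C\in\mathbb{C}^{d\times d}$ with $C_{ii}=0$ and $C_{ij}=C_{ji}=c_{ij}$ for $i<j$. ML degree: write the homogeneous coordinates as $p_1,\dots,p_n$, let $\mathcal{H}=\{p\in\mathbb{CP}^{n-1}\mid p_1\cdots p_n(p_1+\dots+p_n)=0\}$, and for $u\in\mathbb{C}^n$ let $L_u(p)=p_1^{u_1}\cdots p_n^{u_n}/(p_1+\dots+p_n)^{u_1+\dots+u_n}$ be the likelihood function. The ML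 degree $\operatorname{MLdeg}(V)$ of a scaled toric variety $V$ is the number of complex critical points of $L_u$ restricted to $V\setminus\mathcal{H}$ (i.e. points where the differential of $\log L_u$ restricted to $V\setminus\mathcal{H}$ vanishes) for generic $u\in\mathbb{C}^n$. *)

(* Defs.v *)
From mathcomp Require Import all_boot all_order all_algebra.
From mathcomp Require Import mpoly complex.
From mathcomp Require Import reals.
From mathcomp Require Import classical_sets cardinality.

Set Implicit Arguments.
Unset Strict Implicit.
Unset Printing Implicit Defensive.

Import Order.TTheory GRing.Theory Num.Theory.

Local Open Scope ring_scope.
Local Open Scope classical_set_scope.

(* Subsets of CP^(n-1) are given by their sets of homogeneous coordinate
   vectors; projective points are the lines <[x]> spanned by these. *)

Section Projective.
Variables (R : realType) (n : nat).
Local Notation C := R[i].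
Implicit Types (A V : set 'rV[C]_n) (f g : {mpoly C[n]}) (u x v : 'rV[C]_n).

Definition mevalr f x : C := f.@[fun k => x 0 k].

Definition homog_vanishing A : set {mpoly C[n]} :=
  [set f | (exists k : nat, f \is k.-homog) /\
           forall x, A x -> mevalr f x = 0].

Definition proj_zariski_closure A : set 'rV[C]_n :=
  [set x | x != 0 /\ forall f, homog_vanishing A f -> mevalr f x = 0].

(* Zariski tangent space at x of the affine cone over V.  The tangent space of
   V at the projective point <[x]> is its quotient by the line <[x]>. *)
Definition cone_tangent V x : set 'rV[C]_n :=
  [set v | forall f, homog_vanishing V f ->
           \sum_k mevalr f^`M(k) x * v 0 k = 0].

Definition in_H x : Prop := (\prod_k x 0 k) * (\sum_k x 0 k) = 0.

(* The differential at x, in the direction v, of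
   log L_u = \sum_k u_k log p_k - (\sum_k u_k) log (\sum_k p_k).
   It is single-valued although L_u is not, and it vanishes for v = x (x not in H), hence
   is defined on tangent vectors of projective space. *)
Definition dlogL u x v : C :=
  (\sum_k u 0 k * (v 0 k / x 0 k))
  - (\sum_k u 0 k) * ((\sum_k v 0 k) / (\sum_k x 0 k)).

Definition critical_points V u : set {vspace 'rV[C]_n} :=
  [set <[x]>%VS | x in
    [set x | [/\ V x, ~ in_H x & forall v, cone_tangent V x v -> dlogL u x v = 0]]].

(* MLdeg(V) = N; "generic u" means u outside the zero locus of some nonzero
   polynomial g, so N is unique. *)
Definition is_MLdeg V (N : nat) : Prop :=
  exists g : {mpoly C[n]}, g != 0 /\
    forall u, mevalr g u != 0 -> (critical_points V u #= `I_N)%card.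

End Projective.

Section Hypersimplex.
Variables (R : realType) (d : nat).
Local Notation C := R[i].

Definition pairs : Type := {ij : 'I_d * 'I_d | (ij.1 < ij.2)%N}.

Definition npairs : nat := #|{: pairs}|.

Lemma npairsE : npairs = 'C(d, 2).
Proof.
rewrite /npairs card_sig -sum1_card.
rewrite -(pair_big_dep xpredT (fun i j : 'I_d => (i < j)%N) (fun _ _ => 1%N)) /=.
rewrite (exchange_big_dep xpredT) //= -bin2_sum big_mkord.
apply: eq_bigr => j _.
by rewrite (big_ord_narrow (ltnW (ltn_ord j))) sum1_card card_ord.
Qed.

Definition pair_of (k : 'I_npairs) : pairs := enum_val k.

Definition is_scaling (c : pairs -> C) : Prop := forall ij, c ij != 0.

Definition scaling_matrix (c : pairs -> C) : 'M[C]_d :=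
  \matrix_(i, j) if insub (i, j) is Some ij then c ij
                 else if insub (j, i) is Some ji then c ji
                 else 0.

Definition monomial_point (c : pairs -> C) (t : 'I_d -> C) : 'rV[C]_npairs :=
  \row_k (c (pair_of k) * t (val (pair_of k)).1 * t (val (pair_of k)).2).

Definition scaled_toric_variety (c : pairs -> C) : set 'rV[C]_npairs :=
  proj_zariski_closure
    [set monomial_point c t | t in [set t : 'I_d -> C | forall i, t i != 0]].

End Hypersimplex.

(* Main.v *)
Require Import Defs.
From mathcomp Require Import all_boot all_order all_algebra.
From mathcomp Require Import mpoly complex.
From mathcomp Require Import reals.
From mathcomp Require Import classical_sets cardinality.
From mathcomp Require Import boolp separable.
From mathcomp Require Import ring zify.

(** A symmetric matrix of rank three with zero diagonal is the Gram matrix of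
    [d] isotropic vectors of a nondegenerate quadratic form in three variables,
    that is, of [d] points on a conic.  Parametrising the conic by the
    projective line turns the scaling into
    [C_ij = lam_i * lam_j * (z_i - z_j)^2] with pairwise distinct [z_i]
    ([rank3_conic]).

    For any scaling, the points of the variety off the hypersurface [H] are the
    torus points [c_ij * t_i * t_j] ([torus_point]), and the tangent vectors there
    are the [x_ij * (a_i + a_j)] ([cone_tangent_torus], [torus_cone_tangent]).
    A torus point is therefore critical exactly when the numbers [t_i * (C t)_i]
    are proportional to the marginals [b_i = sum_j u_ij] ([critical_pointP]).

    For the conic scaling put [tau_i = lam_i * t_i].  Then
    [t_i * (C t)_i = tau_i * Q(z_i)], where [Q(w) = sum_j (w - z_j)^2 * tau_j] is
    a polynomial of degree two in [w].  Since [tau_i] is a constant multiple of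
    [b_i / Q(z_i)], a critical point is determined by the two roots [x], [y] of
    [Q], and they are distinct because [sum_i tau_i * Q(z_i)] is, up to a factor,
    the discriminant of [Q].  The consistency condition says that [x] and [y] are
    exchanged by the rational map
    [phi(x) = x - S * prod_j (x - z_j) / B(x)], where [S = sum_i b_i] and
    [B(x) = sum_i b_i * prod_(j <> i) (x - z_j)] ([critical_two_cycle],
    [cycle_point_critical]).  So critical points are the two-cycles of [phi].
    Eliminating [y] leaves a polynomial in [x], [cycle_form], of degree
    [(d - 1) * (d - 2)] ([top_coef_cycle_poly]); [phi] acts on its roots as an
    involution without fixed points, and a two-cycle is an orbit of this
    involution.  Hence there are ['C(d - 1, 2)] critical points as soon as the
    roots are simple ([conic_critical_count]).

    Simplicity of the roots for generic [b] is a Bertini type argument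
    ([generic_cycle_poly_separable]).  If the polynomial had a multiple root for
    all [b], then at a general weight vector [b] and a suitable multiple root [x]
    the number [cycle_form z (b + s v) x] would vanish to second order in [s] for
    every direction [v].  But for [v] orthogonal to the vectors [(1)_i] and
    [(prod_(j <> i) (x - z_j))_i] this number is linear in [s], and its slope is
    a Vandermonde determinant for three of the indices, which is not zero
    ([perturb_direction]). *)

Set Implicit Arguments.
Unset Strict Implicit.
Unset Printing Implicit Defensive.
Import Order.TTheory GRing.Theory Num.Theory.

Local Open Scope ring_scope.

(** * The polynomial whose roots are the two-cycles *)

Section CycleForm.
Variables (A : comNzRingType) (d : nat).
Implicit Types (z b : 'I_d -> A) (x : A).

(** Everything is defined over an arbitrary commutative ring, so that the same
    expression serves as a number, as a polynomial in [x] (take [x = 'X]) and as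
    a polynomial in the weights, with [rmorph_cycle_form] relating the three. *)
Definition node_prod z i x : A := \prod_(j | j != i) (x - z j).
Definition node_comb z b x : A := \sum_i b i * node_prod z i x.

(** With [phi x = x - S * prod_j (x - z_j) / node_comb z b x] and [S = sum_i b_i],
    the ratio [(phi x - z_j) / (x - z_j)] is this quantity divided by [node_comb z b x]. *)
Definition node_ratio z b j x : A :=
  node_comb z b x - (\sum_i b i) * node_prod z j x.
(** With [y = phi x] the condition [phi y = x] reads
    [sum_i b_i * (x - z_i) / (y - z_i) = 0]; by the formula for [node_ratio] this
    is [sum_i b_i / node_ratio z b i x = 0], here with denominators cleared. *)
Definition cycle_form z b x : A :=
  \sum_i b i * \prod_(j | j != i) node_ratio z b j x.

(** The leading coefficient of [cycle_form] as a polynomial in [x]; up to a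
    power of [sum_i b_i] it is the value of [node_comb] at the weighted barycentre
    of the nodes, and its vanishing means that infinity lies on a two-cycle. *)
Definition cycle_lead z b : A :=
  \sum_i b i * \prod_(j | j != i) (\sum_k b k * z k - (\sum_k b k) * z j).

Lemma sum_node_ratio z b x : \sum_i b i * node_ratio z b i x = 0.
Proof.
under eq_bigr do rewrite mulrBr mulrCA.
by rewrite sumrB -mulr_suml -mulr_sumr subrr.
Qed.

Lemma node_prodE z i j x : i != j ->
  node_prod z i x = (x - z j) * \prod_(k | (k != i) && (k != j)) (x - z k).
Proof. by move=> ij; rewrite /node_prod (bigD1 j) //= eq_sym. Qed.

Lemma node_prodB z i j x : i != j -> node_prod z i x - node_prod z j x =
  (z i - z j) * \prod_(k | (k != i) && (k != j)) (x - z k).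
Proof.
move=> ij; have ji : j != i by rewrite eq_sym.
rewrite (node_prodE _ _ ij) (node_prodE _ _ ji).
rewrite [in X in _ - X](eq_bigl (fun l => (l != i) && (l != j))); first by ring.
by move=> l; rewrite andbC.
Qed.

(** The two leading terms of [node_comb] and [(sum_i b_i) * node_prod] cancel;
    in this form the degree [d - 2] is visible. *)
Lemma node_ratioE z b j x : node_ratio z b j x = \sum_(i | i != j)
  b i * (z i - z j) * \prod_(k | (k != i) && (k != j)) (x - z k).
Proof.
rewrite /node_ratio /node_comb mulr_suml -sumrB (bigD1 j) //= subrr add0r.
by apply: eq_bigr => i ij; rewrite -mulrBr node_prodB // mulrA.
Qed.

Lemma node_prod_mul z i x : (x - z i) * node_prod z i x = \prod_j (x - z j).
Proof. by rewrite (bigD1 i). Qed.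

Lemma node_prod0 z i j : i != j -> node_prod z i (z j) = 0.
Proof. by move=> ij; rewrite (node_prodE _ _ ij) subrr mul0r. Qed.

Lemma node_comb_at z b k : node_comb z b (z k) = b k * node_prod z k (z k).
Proof.
by rewrite /node_comb (bigD1 k) //= big1 ?addr0 // => i ik; rewrite node_prod0 ?mulr0.
Qed.

(** At a node only the factors [b_k * node_prod] survive in the
    [node_ratio]s, so the value is explicit.  It shows which weights keep the roots
    away from the nodes. *)
Lemma cycle_form_at z b k :
  cycle_form z b (z k) * b k =
  (b k * node_prod z k (z k)) ^+ d.-1 * ((\sum_i b i) * (2 * b k - \sum_i b i)).
Proof.
set p := node_prod _ _ _; set S := \sum_i b i.
have wk : node_ratio z b k (z k) = (b k - S) * p.
  by rewrite /node_ratio node_comb_at -mulrBl.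
have wj j : j != k -> node_ratio z b j (z k) = b k * p.
  by move=> jk; rewrite /node_ratio node_comb_at (node_prod0 _ jk) mulr0 subr0.
rewrite /cycle_form (bigD1 k) //= (eq_bigr (fun=> b k * p)) //.
rewrite prodr_const cardC1 card_ord /=.
have -> : \sum_(i | i != k) b i * \prod_(j | j != i) node_ratio z b j (z k) =
    (S - b k) * ((b k - S) * p * (b k * p) ^+ d.-2).
  have -> : S - b k = \sum_(i | i != k) b i.
    by apply/eqP; rewrite subr_eq addrC [S](bigD1 k).
  rewrite mulr_suml; apply: eq_bigr => i ik.
  congr (_ * _); rewrite (bigD1 k) 1?eq_sym //= wk; congr (_ * _).
  rewrite (eq_bigr (fun=> b k * p)); last by move=> j /andP[_]; exact: wj.
  rewrite prodr_const; congr (_ ^+ _).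
  rewrite (eq_card (B := [predD1 predC1 k & i])); last first.
    by move=> j; rewrite !inE.
  by rewrite -[in RHS](card_ord d) -(cardC1 k) (cardD1 i (predC1 k)) !inE ik.
have [d1|d2] := leqP d 1.
  have bk : S = b k.
    rewrite /S (bigD1 k) //= big1 ?addr0 // => i; rewrite -val_eqE /=.
    by have := ltn_ord i; have := ltn_ord k; lia.
  by rewrite bk (_ : d.-1 = 0) ?expr0; [ring|lia].
by rewrite (_ : d.-1 = d.-2.+1) ?exprS; [ring|lia].
Qed.

(** A root of [node_comb] is sent to infinity by [phi]; the second equation says
    that infinity is sent back to [x], so that [x] is forced to be the
    barycentre. *)
Lemma cycle_lead_eq0 z b x : node_comb z b x = 0 ->
  \sum_i b i * (x - z i) = 0 -> cycle_lead z b = 0.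
Proof.
move=> B0; under eq_bigr do rewrite mulrBr.
rewrite sumrB -mulr_suml => /eqP; rewrite subr_eq0 => /eqP E.
rewrite /cycle_lead -E.
transitivity ((\sum_i b i) ^+ d.-1 * node_comb z b x); last by rewrite B0 mulr0.
rewrite /node_comb mulr_sumr; apply: eq_bigr => i _; rewrite mulrCA; congr (_ * _).
rewrite (eq_bigr (fun j => (\sum_i b i) * (x - z j))) ?big_split /= ?prodr_const.
  by congr (_ ^+ _ * _); rewrite cardC1 card_ord.
by move=> j _; rewrite mulrBr.
Qed.

End CycleForm.

Section Morph.
Variables (A A' : comNzRingType) (f : {rmorphism A -> A'}) (d : nat).
Implicit Types (z b : 'I_d -> A) (x : A).

Lemma rmorph_node_prod z i x :
  f (node_prod z i x) = node_prod (f \o z) i (f x).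
Proof. by rewrite rmorph_prod; apply: eq_bigr => j _; rewrite rmorphB. Qed.

Lemma rmorph_node_comb z b x :
  f (node_comb z b x) = node_comb (f \o z) (f \o b) (f x).
Proof.
by rewrite rmorph_sum; apply: eq_bigr => j _; rewrite rmorphM rmorph_node_prod.
Qed.

Lemma rmorph_node_ratio z b j x :
  f (node_ratio z b j x) = node_ratio (f \o z) (f \o b) j (f x).
Proof.
by rewrite rmorphB rmorph_node_comb rmorphM rmorph_node_prod rmorph_sum.
Qed.

Lemma rmorph_cycle_form z b x :
  f (cycle_form z b x) = cycle_form (f \o z) (f \o b) (f x).
Proof.
rewrite rmorph_sum; apply: eq_bigr => i _; rewrite rmorphM rmorph_prod.
by congr (_ * _); apply: eq_bigr => j _; rewrite rmorph_node_ratio.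
Qed.

Lemma rmorph_cycle_lead z b :
  f (cycle_lead z b) = cycle_lead (f \o z) (f \o b).
Proof.
rewrite rmorph_sum; apply: eq_bigr => i _; rewrite rmorphM rmorph_prod.
congr (_ * _); apply: eq_bigr => j _.
rewrite rmorphB rmorphM !rmorph_sum; congr (_ - _).
by apply: eq_bigr => k _; rewrite rmorphM.
Qed.
End Morph.

Lemma eq_cycle_form (A : comNzRingType) d (z z' b b' : 'I_d -> A) x :
  z =1 z' -> b =1 b' -> cycle_form z b x = cycle_form z' b' x.
Proof.
move=> zz bb; apply: eq_bigr => i _; rewrite bb; congr (_ * _).
apply: eq_bigr => j _; rewrite /node_ratio /node_comb (eq_bigr _ (fun i _ => bb i)).
congr (_ - _ * _); last by apply: eq_bigr => k _; rewrite zz.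
by apply: eq_bigr => k _; rewrite bb; congr (_ * _); apply: eq_bigr => l _; rewrite zz.
Qed.

(** * Two-cycles over a field *)

Section Field.
Variables (F : fieldType) (d : nat) (z b : 'I_d -> F).
Hypothesis z_inj : injective z.
Local Notation S := (\sum_i b i).

(** Explicit open conditions on the weights under which every root of
    [cycle_form] gives a genuine two-cycle in the affine line minus the nodes. *)
Definition good_weights := [/\ forall i, b i != 0, S != 0,
  forall i, 2 * b i != S & cycle_lead z b != 0].

Lemma node_prod_neq0 i x : (forall j, j != i -> x != z j) -> node_prod z i x != 0.
Proof. by move=> h; apply/prodf_neq0 => j /h; rewrite subr_eq0. Qed.

Hypothesis gb : good_weights.

Lemma cycle_form_root_neq x k : cycle_form z b x = 0 -> x != z k.
Proof.
case: gb => b0 S0 b2 _ x0; apply/eqP => xk; move: x0; rewrite xk => x0.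
have /eqP := cycle_form_at z b k; rewrite x0 mul0r eq_sym !mulf_eq0 (negPf S0).
rewrite subr_eq0 (negPf (b2 k)) !orbF expf_eq0 => /andP[_].
rewrite mulf_eq0 (negPf (b0 k)) /=.
apply/negP/node_prod_neq0 => j jk; apply: contraNneq jk => /z_inj ->; exact: eqxx.
Qed.

(** If [node_comb] vanishes, all [node_ratio]s are proportional to the
    [node_prod]s, and [cycle_form] becomes a multiple of
    [sum_i b_i * (x - z_i)]. *)
Lemma cycle_form_root_comb x : cycle_form z b x = 0 -> node_comb z b x != 0.
Proof.
case: (gb) => b0 S0 b2 L0 x0; apply/eqP => B0.
have xz k := cycle_form_root_neq k x0.
have w j : node_ratio z b j x = - S * node_prod z j x.
  by rewrite /node_ratio B0 sub0r mulNr.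
have Pn0 i : node_prod z i x != 0 by apply: node_prod_neq0 => j _; exact: xz.
move/eqP: L0; apply; apply: (cycle_lead_eq0 B0).
  have : cycle_form z b x * \prod_j (x - z j) =
     (\prod_j (- S * node_prod z j x)) * (- S) ^-1 * (\sum_i b i * (x - z i)).
    rewrite /cycle_form mulr_suml [RHS]mulr_sumr.
    apply: eq_bigr => i _.
    have -> : \prod_(j | j != i) node_ratio z b j x =
        \prod_(j | j != i) (- S * node_prod z j x).
      by apply: eq_bigr => j _; exact: w.
    rewrite -(node_prod_mul z i) [in RHS](bigD1 i) //=.
    set q := \prod_(j | _) _.
    field. by rewrite oppr_eq0.
  rewrite x0 mul0r => /esym/eqP; rewrite mulf_eq0 => /orP[|/eqP//].
  rewrite mulf_eq0 invr_eq0 oppr_eq0 (negPf S0) orbF.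
  move=> /eqP/eqP; rewrite prodf_seq_eq0 => /hasP[j _] /=.
  by rewrite mulf_eq0 oppr_eq0 (negPf S0) (negPf (Pn0 j)).
Qed.

(** If one [node_ratio] vanishes at a root then so does a second one, and two of
    them vanish together only at nodes. *)
Lemma cycle_form_root_ratio x j : cycle_form z b x = 0 -> node_ratio z b j x != 0.
Proof.
case: (gb) => b0 S0 b2 L0 x0; apply/eqP => wj.
have xz k := cycle_form_root_neq k x0.
have := x0; rewrite /cycle_form (bigD1 j) //= [X in _ + X]big1 ?addr0; last first.
  by move=> i ij; rewrite (bigD1 j) 1?eq_sym //= wj mul0r mulr0.
move/eqP; rewrite mulf_eq0 (negPf (b0 j)) prodf_seq_eq0 => /hasP[k _] /andP[kj /eqP wk].
have : S * (node_prod z j x - node_prod z k x) = 0.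
  have -> : S * (node_prod z j x - node_prod z k x) =
    node_ratio z b k x - node_ratio z b j x by rewrite /node_ratio; ring.
  by rewrite wk wj subrr.
have jk : j != k by rewrite eq_sym.
rewrite node_prodB //.
apply/eqP; rewrite !mulf_neq0 // ?subr_eq0 ?(inj_eq z_inj) //.
by apply/prodf_neq0 => l _; rewrite subr_eq0.
Qed.

Definition cycle_step x := x - S * (\prod_j (x - z j)) / node_comb z b x.

(** The two equations are symmetric in [x] and [y] and linear in the weights;
    they are [y = phi x] and [x = phi y] with denominators cleared. *)
Definition two_cycle x y :=
  [/\ forall i, x != z i, forall i, y != z i, x != y,
   \sum_i b i * ((y - z i) / (x - z i)) = 0 &
   \sum_i b i * ((x - z i) / (y - z i)) = 0].

Lemma two_cycleC x y : two_cycle x y -> two_cycle y x.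
Proof. by case=> *; split => //; rewrite eq_sym. Qed.

Lemma cycle_step_sub x k : node_comb z b x != 0 ->
  cycle_step x - z k = (x - z k) * node_ratio z b k x / node_comb z b x.
Proof.
move=> B0; rewrite /cycle_step /node_ratio -(node_prod_mul z k).
by field.
Qed.

Lemma cycle_form_prod x : (forall j, node_ratio z b j x != 0) ->
  cycle_form z b x = \prod_j node_ratio z b j x * \sum_i b i / node_ratio z b i x.
Proof.
move=> w0; rewrite mulr_sumr; apply: eq_bigr => i _.
by rewrite [in RHS](bigD1 i) //=; field.
Qed.

Lemma root_two_cycle x : cycle_form z b x = 0 -> two_cycle x (cycle_step x).
Proof.
case: (gb) => b0 S0 b2 L0 x0.
have xz k := cycle_form_root_neq k x0.
have B0 := cycle_form_root_comb x0.
have w0 j := cycle_form_root_ratio j x0.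
have xzk k : x - z k != 0 by rewrite subr_eq0.
split=> //.
- move=> i; rewrite -subr_eq0 cycle_step_sub //.
  by rewrite !mulf_neq0 // invr_eq0.
- rewrite -subr_eq0 /cycle_step opprB addrCA subrr addr0.
  rewrite !mulf_neq0 ?invr_eq0 //; apply/prodf_neq0 => j _; exact: xzk.
- transitivity (\sum_i b i * node_ratio z b i x / node_comb z b x).
    apply: eq_bigr => i _; rewrite cycle_step_sub //; field.
    by rewrite B0 xzk.
  by rewrite -mulr_suml sum_node_ratio mul0r.
- transitivity (node_comb z b x * \sum_i b i / node_ratio z b i x).
    rewrite mulr_sumr; apply: eq_bigr => i _; rewrite cycle_step_sub //; field.
    by rewrite B0 w0 xzk.
  have /eqP := x0; rewrite cycle_form_prod // mulf_eq0 => /orP[|/eqP->]; last by rewrite mulr0.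
  by rewrite prodf_seq_eq0 => /hasP[j _] /=; rewrite (negPf (w0 j)).
Qed.

Lemma two_cycle_root x y : two_cycle x y ->
  cycle_form z b x = 0 /\ y = cycle_step x.
Proof.
case: (gb) => b0 S0 b2 L0 [xz yz xy E1 E2].
have xzk k : x - z k != 0 by rewrite subr_eq0.
have yzk k : y - z k != 0 by rewrite subr_eq0.
set P := \prod_j (x - z j).
have P0 : P != 0 by apply/prodf_neq0 => j _; exact: xzk.
have E : S * P + (y - x) * node_comb z b x = 0.
  have <- : P * \sum_i b i * ((y - z i) / (x - z i)) = S * P + (y - x) * node_comb z b x.
    rewrite mulr_sumr mulr_suml mulr_sumr -big_split; apply: eq_bigr => i _ /=.
    rewrite /P -(node_prod_mul z i); field. exact: xzk.
  by rewrite E1 mulr0.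
have B0 : node_comb z b x != 0.
  apply/eqP => B0; move/eqP: E; rewrite B0 mulr0 addr0 mulf_eq0 (negPf S0).
  by rewrite (negPf P0).
have ys : y = cycle_step x.
  apply/eqP; rewrite -subr_eq0 /cycle_step -/P.
  have -> : y - (x - S * P / node_comb z b x) =
    (S * P + (y - x) * node_comb z b x) / node_comb z b x by field.
  by rewrite E mul0r.
have w0 j : node_ratio z b j x != 0.
  have := yzk j; rewrite ys cycle_step_sub //.
  by apply: contraNneq => ->; rewrite mulr0 mul0r.
split => //; rewrite cycle_form_prod //.
suff : node_comb z b x * \sum_i b i / node_ratio z b i x = 0.
  by move/eqP; rewrite mulf_eq0 (negPf B0) /= => /eqP->; rewrite mulr0.
rewrite -[RHS]E2 ys mulr_sumr; apply: eq_bigr => i _; rewrite cycle_step_sub //; field.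
by rewrite B0 w0 xzk.
Qed.

Lemma cycle_step_root x : cycle_form z b x = 0 ->
  cycle_form z b (cycle_step x) = 0 /\ cycle_step (cycle_step x) = x.
Proof.
by move=> /root_two_cycle/two_cycleC/two_cycle_root[-> <-].
Qed.

End Field.

(** * Degree *)

Section Degree.
Variable A : comNzRingType.
Implicit Types p q : {poly A}.

(** Bounds the degree by [m] and names the coefficient of degree [m], which may
    vanish; unlike [lead_coef] this is compatible with sums and products over any
    ring. *)
Definition top_coef m p c := (size p <= m.+1)%N /\ p`_m = c.

Lemma top_coefM m k p q a c :
  top_coef m p a -> top_coef k q c -> top_coef (m + k) (p * q) (a * c).
Proof.
move=> [sp <-] [sq <-]; split.
  apply: (leq_trans (size_polyMleq _ _)).
  by rewrite -subn1 leq_subLR add1n -addnS -addSn leq_add.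
rewrite coefM (bigD1 (Ordinal (ltn_addr k (ltnSn m)))) //= addKn big1 ?addr0 //.
move=> i; rewrite -val_eqE /= => im.
have [lt|ge] := ltnP i m.
  by rewrite [q`__]nth_default ?mulr0 //; apply: (leq_trans sq); rewrite ltn_subRL ltn_add2r.
by rewrite [p`__]nth_default ?mul0r //; apply: (leq_trans sp); rewrite ltn_neqAle eq_sym im.
Qed.

Lemma top_coef_const a : top_coef 0 a%:P a.
Proof. by split; rewrite ?size_polyC_leq1 ?coefC. Qed.

Lemma top_coef_prod (I : finType) (P : pred I) (p : I -> {poly A}) m c :
  (forall i, P i -> top_coef m (p i) (c i)) ->
  top_coef (#|P| * m) (\prod_(i | P i) p i) (\prod_(i | P i) c i).
Proof.
move=> h; rewrite -sum_nat_const.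
apply: (big_rec3 (fun n q a => top_coef n q a)); first exact: top_coef_const.
by move=> i n q a Pi IH; exact: top_coefM (h i Pi) IH.
Qed.

Lemma top_coef_sum (I : finType) (P : pred I) (p : I -> {poly A}) m c :
  (forall i, P i -> top_coef m (p i) (c i)) ->
  top_coef m (\sum_(i | P i) p i) (\sum_(i | P i) c i).
Proof.
move=> h; apply: (big_rec2 (fun q a => top_coef m q a)).
  by split; rewrite ?size_poly0 ?coef0.
move=> i q a Pi [sq <-]; have [sp <-] := h i Pi; split; last by rewrite coefD.
by rewrite (leq_trans (size_polyD _ _)) // geq_max sp.
Qed.

Variables (d : nat).
Implicit Types (z b : 'I_d -> A).

Definition cycle_poly z b : {poly A} := cycle_form (polyC \o z) (polyC \o b) 'X.

Lemma top_coef_XsubC a : top_coef 1 ('X - a%:P) 1.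
Proof. by split; rewrite ?size_XsubC // coefB coefX coefC subr0. Qed.

Lemma top_coef_node_ratio z b j :
  top_coef d.-2 (node_ratio (polyC \o z) (polyC \o b) j 'X)
    (\sum_k b k * z k - (\sum_k b k) * z j).
Proof.
rewrite node_ratioE.
have -> : \sum_k b k * z k - (\sum_k b k) * z j =
  \sum_(i | i != j) b i * (z i - z j) * \prod_(k | (k != i) && (k != j)) 1.
  under [RHS]eq_bigr do rewrite big1 // mulr1 mulrBr.
  by rewrite mulr_suml -sumrB (bigD1 j) //= subrr add0r.
apply: top_coef_sum => i ij.
rewrite -[d.-2]add0n; apply: top_coefM.
  by rewrite /= -polyCB -polyCM; exact: top_coef_const.
have -> : d.-2 = (#|[pred k | (k != i) && (k != j)]| * 1)%N.
  rewrite muln1 (eq_card (B := [predD1 predC1 i & j])); last first.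
    by move=> k; rewrite !inE andbC.
  have := cardC1 i; rewrite card_ord (cardD1 j (predC1 i)) !inE eq_sym ij.
  by move=> <-.
by apply: top_coef_prod => k _; exact: top_coef_XsubC.
Qed.

Lemma top_coef_cycle_poly z b :
  top_coef (d.-1 * d.-2) (cycle_poly z b) (cycle_lead z b).
Proof.
apply: top_coef_sum => i _; rewrite -[(d.-1 * _)%N]add0n.
apply: top_coefM; first exact: top_coef_const.
rewrite -[d in (d.-1 * _)%N]card_ord -(cardC1 i).
by apply: top_coef_prod => j _; exact: top_coef_node_ratio.
Qed.

Lemma horner_cycle_poly z b x : (cycle_poly z b).[x] = cycle_form z b x.
Proof.
rewrite -[LHS]/(horner_eval x _) rmorph_cycle_form /= /horner_eval hornerX.
by apply: eq_cycle_form => i /=; rewrite hornerC.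
Qed.

Lemma map_cycle_poly (A' : comNzRingType) (f : {rmorphism A -> A'}) z b :
  map_poly f (cycle_poly z b) =
  cycle_form (fun i => (f (z i))%:P) (fun i => (f (b i))%:P) 'X.
Proof.
rewrite [LHS]rmorph_cycle_form /= map_polyX.
by apply: eq_cycle_form => i /=; rewrite map_polyC.
Qed.
End Degree.

(** * Polynomials along curves *)

Section Curve.
Variables (A : comNzRingType) (n : nat).
Implicit Types (g : 'I_n -> {poly A}) (p q : {mpoly A[n]}).

Lemma horner_mmap g p s :
  (mmap (@polyC A) g p).[s] = p.@[fun k => (g k).[s]].
Proof.
rewrite /meval /mmap horner_sum; apply: eq_bigr => m _.
rewrite hornerM hornerC; congr (_ * _).
by rewrite /mmap1 horner_prod; apply: eq_bigr => i _; rewrite horner_exp.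
Qed.

(** Chain rule.  Both sides are derivations along the substitution, so it is
    enough to compare them on constants and variables. *)
Lemma deriv_mmap g p : (mmap (@polyC A) g p)^`() =
  \sum_k mmap (@polyC A) g p^`M(k) * (g k)^`().
Proof.
pose Q p := (mmap (@polyC A) g p)^`() =
  \sum_k mmap (@polyC A) g p^`M(k) * (g k)^`().
have QC c : Q c%:MP.
  rewrite /Q mmapC derivC big1 // => k _.
  by rewrite mderivC rmorph0 mul0r.
have QD q r : Q q -> Q r -> Q (q + r).
  rewrite /Q rmorphD derivD => -> ->; rewrite -big_split; apply: eq_bigr => k _.
  by rewrite mderivD rmorphD mulrDl.
have QM q r : Q q -> Q r -> Q (q * r).
  rewrite /Q rmorphM derivM => -> ->; rewrite mulr_suml mulr_sumr -big_split.
  by apply: eq_bigr => k _ /=; rewrite mderivM rmorphD !rmorphM /=; ring.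
have QX i : Q 'X_i.
  rewrite /Q mmapX mmap1U (bigD1 i) //= big1 ?addr0 => [|k ki]; last first.
    by rewrite mderivX mnmE eq_sym (negPf ki) scale0r rmorph0 mul0r.
  by rewrite mderivX mnmE eqxx scale1r -{1}[U_(i)%MM]add0m addmK mpolyX0 rmorph1 mul1r.
elim/mpolyind: p => [|c m p _ _ IH]; first by have := QC 0; rewrite mpolyC0.
apply: QD IH; rewrite -mul_mpolyC; apply: (QM) => //; rewrite mpolyXE_id.
elim/big_ind: _ => [|q r|i _]; [by have := QC 1; rewrite mpolyC1|exact: QM|].
elim: (m i) => [|k IH]; first by rewrite expr0; have := QC 1; rewrite mpolyC1.
by rewrite exprS; exact: QM.
Qed.

End Curve.

Lemma horner_eq0 (F : numFieldType) (p : {poly F}) : (forall s, p.[s] = 0) -> p = 0.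
Proof.
move=> p0; apply/eqP; apply: contraT => pn0.
pose r := [seq n%:R | n <- iota 0 (size p)] : seq F.
have := max_poly_roots (rs := r) pn0; rewrite size_map size_iota ltnn; apply.
  by apply/allP => s _; rewrite rootE p0.
by rewrite map_inj_uniq ?iota_uniq // => m n /eqP; rewrite eqr_nat => /eqP.
Qed.

(** Induction on the degree of the monomial: if a polynomial vanishes
    everywhere, so do its restrictions to lines and hence its partial derivatives,
    whose coefficients are those of the polynomial up to nonzero integers. *)
Lemma meval_eq0 (F : numFieldType) n (p : {mpoly F[n]}) :
  (forall v, p.@[v] = 0) -> p = 0.
Proof.
move=> p0; apply/mpolyP => m; rewrite mcoeff0.
have [k km] : {k | mdeg m <= k}%N by exists (mdeg m).
elim: k m p p0 km => [|k IH] m p p0 km.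
  have -> : m = 0%MM by apply/eqP; rewrite -mdeg_eq0; lia.
  rewrite -(p0 (fun=> 0)) mevalE.
  have [s|s] := boolP (0%MM \in msupp p).
    rewrite (bigD1_seq _ s) //= ?msupp_uniq // [X in _ * X]big1; last first.
      by move=> i _; rewrite mnmE expr0.
    rewrite mulr1 big1 ?addr0 // => m' m'0.
    have /existsP[i mi] : [exists i, m' i != 0%N].
      apply: contraNT m'0; rewrite negb_exists => /forallP h.
      by apply/eqP/mnmP => i; rewrite mnmE; apply/eqP; have := h i; rewrite negbK.
    by rewrite (bigD1 i) //= expr0n (negPf mi) mul0r mulr0.
  rewrite (memN_msupp_eq0 s) big1_seq // => m' /= m's.
  have /existsP[i mi] : [exists i, m' i != 0%N].
    apply: contraNT s; rewrite negb_exists => /forallP h.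
    rewrite (_ : 0%MM = m') //.
    by apply/mnmP => i; rewrite mnmE; apply/esym/eqP; have := h i; rewrite negbK.
  by rewrite (bigD1 i) //= expr0n (negPf mi) mul0r mulr0.
have [m0|/existsP[i mi]] := boolP [forall i, m i == 0%N].
  apply: IH => //; rewrite leq_eqVlt in km; case/orP: km => // /eqP km.
  have : m = 0%MM by apply/mnmP => i; rewrite mnmE; apply/eqP; move/forallP: m0; exact.
  by move/eqP; rewrite -mdeg_eq0 => /eqP; lia.
have mE : (m - U_(i) + U_(i))%MM = m.
  by apply/mnmP => j; rewrite !mnmE; case: eqP => [<-|_]; lia.
have : p^`M(i)@_(m - U_(i)) = 0.
  apply: IH; last by move: km; rewrite -mE mdegD mdeg1 mE; lia.
  move=> v; pose g k := (v k)%:P + (k == i)%:R *: 'X : {poly F}.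
  have g0 : mmap (@polyC F) g p = 0 by apply: horner_eq0 => s; rewrite horner_mmap.
  have := congr1 (fun q => q^`().[0]) g0; rewrite /= deriv_mmap deriv0 horner0.
  rewrite horner_sum (bigD1 i) //= big1 ?addr0 => [|j ki]; last first.
    by rewrite /g derivD derivC derivZ (negPf ki) scale0r addr0 mulr0 horner0.
  rewrite /g derivD derivC derivZ derivX eqxx scale1r add0r mulr1 horner_mmap.
  by under meval_eq do rewrite !hornerE.
rewrite mcoeff_deriv mE => /eqP; rewrite mulrn_eq0 /= => /eqP//.
Qed.

Lemma meval_neq0 (F : numFieldType) n (p : {mpoly F[n]}) :
  p != 0 -> exists v, p.@[v] != 0.
Proof.
move=> pn0; apply/not_existsP => h; move/eqP: pn0; apply.
by apply: meval_eq0 => v; apply/eqP; apply: contraT => /h.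
Qed.

(** * Moving the weights at a fixed root *)

Section Perturb.
Variables (A : comNzRingType) (d : nat) (z b v : 'I_d -> A) (s x : A).
Hypothesis v0 : \sum_i v i = 0.
Hypothesis v1 : \sum_i v i * node_prod z i x = 0.

Lemma node_ratio_perturb j :
  node_ratio z (fun i => b i + s * v i) j x = node_ratio z b j x.
Proof.
rewrite /node_ratio /node_comb.
under eq_bigr do rewrite mulrDl -mulrA.
by rewrite !big_split /= -!mulr_sumr v0 v1 !mulr0 !addr0.
Qed.

(** For such a direction [v] the quantities [node_ratio z b j x] do not move, so
    that only the explicit occurrence of the weights contributes. *)
Lemma cycle_form_perturb : cycle_form z (fun i => b i + s * v i) x =
  cycle_form z b x + s * \sum_i v i * \prod_(j | j != i) node_ratio z b j x.
Proof.
rewrite mulr_sumr -big_split; apply: eq_bigr => i _ /=.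
rewrite mulrA -mulrDl; congr (_ * _).
by apply: eq_bigr => j _; exact: node_ratio_perturb.
Qed.
End Perturb.

Lemma sum3 (A : nmodType) (I : finType) (i0 i1 i2 : I) (f : I -> A) :
  i0 != i1 -> i0 != i2 -> i1 != i2 ->
  (forall i, i != i0 -> i != i1 -> i != i2 -> f i = 0) ->
  \sum_i f i = f i0 + f i1 + f i2.
Proof.
move=> n01 n02 n12 f0; rewrite (bigD1 i0) //= (bigD1 i1) 1?eq_sym //=.
rewrite (bigD1 i2) /= ?[i2 == _]eq_sym ?n02 // big1 ?addr0 ?addrA //.
by move=> i /andP[/andP[? ?] ?]; exact: f0.
Qed.

Lemma three_nodes d : (3 <= d)%N -> exists i0 i1 i2 : 'I_d,
  [/\ i0 != i1, i0 != i2 & i1 != i2].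
Proof.
move=> hd; exists (Ordinal (leq_trans (isT : 0 < 3)%N hd)).
exists (Ordinal (leq_trans (isT : 1 < 3)%N hd)).
by exists (Ordinal (leq_trans (isT : 2 < 3)%N hd)).
Qed.

(** Take [v] supported on three indices, the cross product there of [(1, 1, 1)]
    with the [node_prod]s.  Since [node_ratio] is an affine function of
    [node_prod], the slope is a Vandermonde determinant in three distinct
    [node_ratio]s. *)
Lemma perturb_direction (F : fieldType) d (z b : 'I_d -> F) x : (3 <= d)%N ->
  injective z -> good_weights z b -> cycle_form z b x = 0 ->
  exists v : 'I_d -> F, [/\ \sum_i v i = 0,
     \sum_i v i * node_prod z i x = 0 &
     \sum_i v i * \prod_(j | j != i) node_ratio z b j x != 0].
Proof.
move=> hd z_inj gb x0; have [i0 [i1 [i2 [n01 n02 n12]]]] := three_nodes hd.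
have xz k := cycle_form_root_neq z_inj gb k x0.
have w0 j := cycle_form_root_ratio z_inj gb j x0.
have S0 : \sum_i b i != 0 by case: gb.
pose P i := node_prod z i x; pose w i := node_ratio z b i x.
have PD i j : i != j -> w i != w j.
  move=> ij; rewrite -subr_eq0 /w /node_ratio.
  have -> : node_comb z b x - (\sum_i b i) * node_prod z i x -
    (node_comb z b x - (\sum_i b i) * node_prod z j x) =
    (\sum_i b i) * (node_prod z j x - node_prod z i x) by ring.
  have ji : j != i by rewrite eq_sym.
  rewrite (node_prodB _ _ ji) !mulf_neq0 // ?subr_eq0 ?(inj_eq z_inj) //.
  by apply/prodf_neq0 => k _; rewrite subr_eq0.
pose v i := if i == i0 then P i1 - P i2 else if i == i1 then P i2 - P i0
   else if i == i2 then P i0 - P i1 else 0.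
have n10 : i1 != i0 by rewrite eq_sym.
have n20 : i2 != i0 by rewrite eq_sym.
have n21 : i2 != i1 by rewrite eq_sym.
have vs (f : 'I_d -> F) : \sum_i v i * f i =
    (P i1 - P i2) * f i0 + (P i2 - P i0) * f i1 + (P i0 - P i1) * f i2.
  rewrite (sum3 n01 n02 n12) => [|i a0 a1 a2].
    by rewrite /v !eqxx (negPf n10) (negPf n20) (negPf n21).
  by rewrite /v (negPf a0) (negPf a1) (negPf a2) mul0r.
exists v; split.
- by have := vs (fun=> 1); under eq_bigr do rewrite mulr1; move->; ring.
- by rewrite vs /P; ring.
have -> : \sum_i v i * \prod_(j | j != i) node_ratio z b j x =
    \prod_j w j * \sum_i v i * (w i)^-1.
  rewrite mulr_sumr; apply: eq_bigr => i _; rewrite [in RHS](bigD1 i) //= /w; field.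
  exact: w0.
rewrite mulf_neq0 //; first by apply/prodf_neq0 => j _; exact: w0.
rewrite vs -(inj_eq (mulfI S0)) mulr0.
have PE i : (\sum_i b i) * P i = node_comb z b x - w i by rewrite /w /node_ratio /P; ring.
rewrite !mulrDr !(mulrA (\sum_i b i)) !mulrBr !PE.
have -> : (node_comb z b x - w i1 - (node_comb z b x - w i2)) / w i0 +
    (node_comb z b x - w i2 - (node_comb z b x - w i0)) / w i1 +
    (node_comb z b x - w i0 - (node_comb z b x - w i1)) / w i2 =
   (w i0 - w i1) * (w i1 - w i2) * (w i2 - w i0) / (w i0 * w i1 * w i2).
  by field; rewrite /w !w0.
have wn i : w i != 0 by exact: w0.
by rewrite !mulf_neq0 ?invr_neq0 ?mulf_neq0 ?wn // subr_eq0 PD.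
Qed.

(** * Common divisors without multiple factors *)

Section CommonDivisor.
Variable A : idomainType.
Hypothesis A0 : forall (a : A) n, a *+ n.+1 = 0 -> a = 0.
Implicit Types p q h : {poly A}.

Lemma deriv_neq0 h : (1 < size h)%N -> h^`() != 0.
Proof.
move=> sh; apply: contraTneq sh => h0; rewrite -leqNgt.
case: (leqP (size h) 1) => // sh.
have := congr1 (fun q : {poly A} => q`_((size h).-2)) h0.
rewrite coef0 coef_deriv => /A0.
rewrite (_ : (size h).-2.+1 = (size h).-1); last by case: (size h) sh => [|[]].
move/eqP; rewrite -/(lead_coef h) lead_coef_eq0 => /eqP h00.
by rewrite h00 size_poly0 in sh.
Qed.

(** Choosing a common divisor of small degree makes it coprime to its own
    derivative: otherwise the gcd of the two is a smaller common divisor. *)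
Lemma common_divisor_separable p q : p != 0 -> ~~ coprimep p q ->
  exists h, [/\ (1 < size h)%N, h %| p, h %| q & coprimep h h^`()].
Proof.
move=> p0 npq.
have [k] := ubnP (size (gcdp p q)).
have : (1 < size (gcdp p q))%N.
  rewrite ltn_neqAle eq_sym -coprimep_def npq /= lt0n size_poly_eq0.
  by rewrite gcdp_eq0 (negPf p0).
have := dvdp_gcdr p q; have := dvdp_gcdl p q.
elim: k (gcdp p q) => // k IH h hp hq sh; rewrite ltnS => hk.
have [cop|ncop] := boolP (coprimep h h^`()); first by exists h.
have h'0 := deriv_neq0 sh.
have h0 : h != 0 by rewrite -size_poly_gt0; exact: ltnW.
apply: (IH (gcdp h h^`())).
- exact: dvdp_trans (dvdp_gcdl _ _) hp.
- exact: dvdp_trans (dvdp_gcdl _ _) hq.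
- rewrite ltn_neqAle eq_sym -coprimep_def ncop /= lt0n size_poly_eq0.
  by rewrite gcdp_eq0 (negPf h0).
apply: leq_trans hk; apply: leq_ltn_trans (lt_size_deriv h0).
exact: dvdp_leq h'0 (dvdp_gcdr _ _).
Qed.
End CommonDivisor.

(** * Simple roots for generic weights *)

Section Generic.
Variables (F : numClosedFieldType) (d : nat) (z : 'I_d -> F).
Hypotheses (hd : (3 <= d)%N) (z_inj : injective z).
Local Notation A := {mpoly F[d]}.

Let zA (i : 'I_d) : A := (z i)%:MP.
Let bA (i : 'I_d) : A := 'X_i.

Definition generic_cycle_poly : {poly A} := cycle_poly zA bA.

(** The weights become indeterminates; this polynomial cuts out the complement
    of [good_weights]. *)
Definition good_locus : A := (\prod_i 'X_i) * (\sum_i 'X_i) *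
  (\prod_i (2 * 'X_i - \sum_j 'X_j)) * cycle_lead zA bA.

Lemma meval_cycle_lead b : (cycle_lead zA bA).@[b] = cycle_lead z b.
Proof.
rewrite rmorph_cycle_lead; congr cycle_lead; apply/funext => i /=.
  by rewrite mevalC.
by rewrite mevalXU.
Qed.

Lemma meval_sumX (b : 'I_d -> F) : (\sum_(i < d) 'X_i).@[b] = \sum_i b i.
Proof. by rewrite rmorph_sum; apply: eq_bigr => i _; rewrite /= mevalXU. Qed.

Lemma good_locusP b : good_locus.@[b] != 0 -> good_weights z b.
Proof.
rewrite /good_locus !mevalM !mulf_eq0 !negb_or meval_cycle_lead meval_sumX.
rewrite !rmorph_prod /= => /andP[/andP[/andP[/prodf_neq0 h1 h2] /prodf_neq0 h3] h4].
split=> // i; first by have := h1 i isT; rewrite mevalXU.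
by have := h3 i isT; rewrite mevalB meval_sumX mevalM mevalXU rmorph_nat subr_eq0.
Qed.

Lemma neq0_of_meval (p : A) b : p.@[b] != 0 -> p != 0.
Proof. by apply: contraNneq => ->; rewrite meval0. Qed.

Lemma good_locus_neq0 : good_locus != 0.
Proof.
(* Each factor gets its own witness: all weights equal to one for the first
   three, the weight concentrated at [i0] for the last. *)
have i0 : 'I_d by exact: Ordinal hd.
have S1 : (\sum_(i < d) 'X_i : A).@[fun=> 1] = d%:R.
  by rewrite meval_sumX sumr_const card_ord.
rewrite /good_locus !mulf_neq0 //.
- apply/prodf_neq0 => i _; apply: (@neq0_of_meval _ (fun=> 1)).
  by rewrite mevalXU oner_eq0.
- apply: (@neq0_of_meval _ (fun=> 1)); rewrite S1 pnatr_eq0; lia.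
- apply/prodf_neq0 => i _; apply: (@neq0_of_meval _ (fun=> 1)).
  rewrite mevalB mevalM S1 rmorph_nat mevalXU mulr1 subr_eq0 eqr_nat; lia.
apply: (@neq0_of_meval _ (fun i => (i == i0)%:R)); rewrite meval_cycle_lead.
have sE (f : 'I_d -> F) : \sum_k (k == i0)%:R * f k = f i0.
  rewrite (bigD1 i0) //= eqxx mul1r big1 ?addr0 // => k /negPf->.
  by rewrite mul0r.
rewrite /cycle_lead sE; apply/prodf_neq0 => j ji.
rewrite sE (_ : \sum_k _ = 1); last first.
  by rewrite -[RHS](sE (fun=> 1)); apply: eq_bigr => k _; rewrite mulr1.
by rewrite mul1r subr_eq0 (inj_eq z_inj) eq_sym.
Qed.

Lemma map_generic_cycle_poly b :
  map_poly (meval b) generic_cycle_poly = cycle_poly z b.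
Proof.
rewrite map_cycle_poly; apply: eq_cycle_form => i /=; first by rewrite mevalC.
by rewrite mevalXU.
Qed.

Lemma mpoly_natmul_eq0 (a : A) n : a *+ n.+1 = 0 -> a = 0.
Proof.
by rewrite -scaler_nat => /eqP; rewrite scaler_eq0 pnatr_eq0 => /eqP.
Qed.

(** Suppose [h] is a common divisor of the polynomial [p] and its derivative,
    coprime to its own derivative, with [c *: p = q * h].  Specialise the weights so
    that nothing degenerates and take a root [x] of [h].  Differentiating
    [c *: p = q * h] shows [q x = 0], because [h] has a simple root there.  Hence
    along every line of weights [p x] vanishes to order two, one order for [q] and
    one for [h], contrary to [perturb_direction]. *)
Lemma generic_cycle_poly_separable :
  coprimep generic_cycle_poly generic_cycle_poly^`().
Proof.
set p := generic_cycle_poly.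
have p0 : p != 0.
  have [b Lb] := meval_neq0 good_locus_neq0.
  have [_ _ _ L0] := good_locusP Lb.
  apply: contra_neq L0 => p0; have [_ <-] := top_coef_cycle_poly z b.
  by rewrite -map_generic_cycle_poly -/p p0 rmorph0 coef0.
apply: contraT => /(common_divisor_separable mpoly_natmul_eq0 p0).
case=> h [sh /Pdiv.Idomain.dvdpP[[c q] /= c0 cE]].
case/Pdiv.Idomain.dvdpP=> [[c' q'] /= c'0 cE'] cop.
have /Bezout_coprimepP[[u v] /= /eqpP[[e e'] /= /andP[e0 e'0] eE]] := cop.
have lh0 : lead_coef h != 0.
  by rewrite lead_coef_eq0 -size_poly_gt0; exact: ltnW.
have [b] : exists b, (good_locus * (c * c' * (e' * lead_coef h))).@[b] != 0.
  by apply: meval_neq0; rewrite mulf_neq0 ?good_locus_neq0 ?mulf_neq0.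
rewrite mevalM mulf_eq0 negb_or => /andP[/good_locusP gb].
rewrite !mevalM !mulf_eq0 !negb_or => /andP[/andP[cb0 cb'0] /andP[eb'0 hb0]].
pose ev := map_poly (meval b).
have sev : size (ev h) = size h by rewrite /ev size_map_poly_id0.
have /closed_rootP[x /rootP hx] : size (ev h) != 1 by rewrite sev gtn_eqF.
have evp : ev p = cycle_poly z b := map_generic_cycle_poly b.
have evZ a r : ev (a *: r) = a.@[b] *: ev r by rewrite /ev map_polyZ.
have evM r1 r2 : ev (r1 * r2) = ev r1 * ev r2 by rewrite /ev rmorphM.
have evD r1 r2 : ev (r1 + r2) = ev r1 + ev r2 by rewrite /ev rmorphD.
have ev' r : ev r^`() = (ev r)^`() by rewrite /ev deriv_map.
have cEb : c.@[b] *: ev p = ev q * ev h by rewrite -evZ cE evM.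
have px : cycle_form z b x = 0.
  have := congr1 (horner^~ x) cEb; rewrite /= hornerM hx mulr0 hornerZ.
  by rewrite evp horner_cycle_poly => /eqP; rewrite mulf_eq0 (negPf cb0) => /eqP.
have p'x : (ev p)^`().[x] = 0.
  have : c'.@[b] *: (ev p)^`() = ev q' * ev h.
    by rewrite -ev' -evZ cE' evM.
  move/(congr1 (horner^~ x)); rewrite /= hornerM hx mulr0 hornerZ => /eqP.
  by rewrite mulf_eq0 (negPf cb'0) => /eqP.
have h'x : (ev h)^`().[x] != 0.
  apply: contraNneq eb'0 => h'x.
  have := congr1 (fun r => (ev r).[x]) eE.
  rewrite !evZ evD !evM ev' [ev 1]rmorph1.
  rewrite !hornerE hx h'x !mulr0 addr0 mulr0 => <-.
  exact: eqxx.
have qx : (ev q).[x] = 0.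
  have := congr1 (fun r => r^`().[x]) cEb.
  rewrite /= derivZ derivM hornerZ p'x mulr0 hornerD !hornerM hx mulr0 add0r.
  by move/esym/eqP; rewrite mulf_eq0 (negPf h'x) orbF => /eqP.
have [w [w0 w1 k0]] := perturb_direction hd z_inj gb px.
set kappa := \sum_i _ in k0.
(* The weights move along [b + s * w]; the polynomial variable is [s]. *)
pose line := mmap (@polyC F) (fun k => (b k)%:P + 'X * (w k)%:P) : A -> {poly F}.
pose el (r : {poly A}) : {poly F} := (map_poly line r).[x%:P].
have line0 a : (line a).[0] = a.@[b].
  rewrite horner_mmap; apply: meval_eq => k.
  by rewrite !hornerE.
have el0 r : (el r).[0] = (ev r).[x].
  rewrite -[LHS]/(horner_eval 0 (el r)) /el -horner_map /= -map_poly_comp /=.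
  rewrite [horner_eval 0 _]hornerC; congr (horner _ x).
  by apply: eq_map_poly => a; exact: line0.
(* At the fixed point [x] the form is linear in [s] along this line. *)
have elp : el p = 'X * kappa%:P.
  rewrite /el map_cycle_poly -[_.[_]]/(horner_eval x%:P _) rmorph_cycle_form /=.
  rewrite /horner_eval hornerX.
  rewrite (eq_cycle_form (z' := polyC \o z)
    (b' := fun i => (b i)%:P + 'X * (w i)%:P) x%:P); first last.
  - by move=> i /=; rewrite hornerC /line /bA mmapX mmap1U.
  - by move=> i /=; rewrite hornerC /line /zA mmapC.
  rewrite (@cycle_form_perturb _ _ _ (polyC \o b) (polyC \o w)); first last.
  - rewrite -[RHS](rmorph0 (@polyC F)) -w1 rmorph_sum; apply: eq_bigr => i _.
    by rewrite rmorphM rmorph_node_prod.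
  - by rewrite -[RHS](rmorph0 (@polyC F)) -w0 rmorph_sum.
  rewrite -rmorph_cycle_form /= px add0r; congr (_ * _).
  rewrite /kappa rmorph_sum; apply: eq_bigr => i _; rewrite rmorphM rmorph_prod.
  by congr (_ * _); apply: eq_bigr => j _; rewrite rmorph_node_ratio.
have elE : line c * el p = el q * el h.
  by rewrite /el -hornerM -rmorphM -cE /= map_polyZ hornerZ.
have := congr1 (fun r : {poly F} => r^`().[0]) elE.
rewrite elp /= !derivM derivX derivC mulr0 addr0 mul1r.
rewrite !hornerD !hornerM hornerX mul0r mulr0 add0r hornerC line0 !el0.
rewrite qx hx mulr0 mul0r addr0 => /eqP.
by rewrite mulf_eq0 (negPf cb0) (negPf k0).
Qed.
End Generic.

(** * Counting the critical points of a conic *)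

(** Of each orbit keep the element that occurs first in [s]. *)
Lemma half_orbits (T : eqType) (s : seq T) (f : T -> T) : uniq s ->
  (forall x, x \in s -> [/\ f x \in s, f (f x) = x & f x != x]) ->
  exists r, [/\ uniq r, (size r).*2 = size s, {subset r <= s},
     forall x, x \in s -> (x \in r) || (f x \in r) &
     forall x, x \in r -> f x \notin r].
Proof.
move=> us fs; pose P x := (index x s < index (f x) s)%N.
have fP x : x \in s -> P (f x) = ~~ P x.
  move=> xs; have [fxs ffx fxn] := fs x xs.
  rewrite /P ffx -leqNgt ltn_neqAle; case: eqVneq => //= ii.
  by move: fxn; rewrite -(nth_index x fxs) ii nth_index ?eqxx.
have perm_fs : perm_eq (map f s) s.
  apply: uniq_perm => //.
    rewrite map_inj_in_uniq // => x y /fs[_ fx _] /fs[_ fy _] fxy.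
    by rewrite -fx fxy.
  move=> x; apply/mapP/idP => [[y ys ->]|xs]; first by case: (fs y ys).
  by have [fxs ffx _] := fs x xs; exists (f x).
exists [seq x <- s | P x]; split.
- exact: filter_uniq.
- rewrite size_filter -addnn -[RHS](count_predC P); congr (_ + _)%N.
  have /permP <- := perm_fs; rewrite count_map; apply: eq_in_count => x xs /=.
  exact: fP.
- by move=> x; rewrite mem_filter => /andP[].
- move=> x xs; have [fxs _ _] := fs x xs.
  by rewrite !mem_filter xs fxs !andbT fP // orbN.
- by move=> x; rewrite !mem_filter => /andP[Px xs]; rewrite fP // Px.
Qed.

Section Weighted.
Variables (F : numClosedFieldType) (d : nat) (z : 'I_d -> F).
Hypotheses (hd : (3 <= d)%N) (z_inj : injective z).
Implicit Types (b t : 'I_d -> F).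

Definition conic_form t w : F := \sum_j (w - z j) ^+ 2 * t j.

Definition conic_energy t : F := \sum_i t i * conic_form t (z i).

Definition conic_critical b t : Prop := [/\ forall i, t i != 0,
  conic_energy t != 0 &
  forall i, (\sum_k b k) * (t i * conic_form t (z i)) = conic_energy t * b i].

Definition cycle_point b x y (i : 'I_d) : F := b i / ((z i - x) * (z i - y)).

Lemma conic_formE t w : conic_form t w =
  (\sum_j t j) * w ^+ 2 - 2 * (\sum_j t j * z j) * w + \sum_j t j * z j ^+ 2.
Proof.
rewrite mulr_sumr !mulr_suml -sumrB -big_split.
by apply: eq_bigr => j _ /=; ring.
Qed.

Lemma sum_quadratic t p q r : \sum_i t i * (p * z i ^+ 2 - q * z i + r) =
  p * (\sum_j t j * z j ^+ 2) - q * (\sum_j t j * z j) + r * (\sum_j t j).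
Proof.
rewrite !mulr_sumr -sumrB -big_split; apply: eq_bigr => i _ /=; ring.
Qed.

(** Up to a constant the energy is the discriminant of the quadratic polynomial
    [conic_form t]. *)
Lemma conic_energyE t : conic_energy t =
  2 * ((\sum_j t j) * (\sum_j t j * z j ^+ 2) - (\sum_j t j * z j) ^+ 2).
Proof.
set m0 := \sum_j t j; set m1 := \sum_j t j * z j; set m2 := \sum_j t j * z j ^+ 2.
transitivity (m0 * m2 - 2 * m1 * m1 + m2 * m0); last by ring.
by rewrite -sum_quadratic; apply: eq_bigr => i _ /=; rewrite conic_formE.
Qed.

Lemma conic_formZ t t' mu w : (forall i, t i = mu * t' i) ->
  conic_form t w = mu * conic_form t' w.
Proof. by move=> h; rewrite mulr_sumr; apply: eq_bigr => j _; rewrite h; ring. Qed.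

(** The two-cycle equations say that [conic_form] vanishes at [x] and [y]; it
    cannot vanish identically because integrating [(z - x) * (z - y)] against
    [cycle_point] gives [sum_i b_i]. *)
Lemma conic_form_cycle_point b x y : two_cycle z b x y ->
  \sum_i b i != 0 ->
  exists2 m, m != 0 & forall w, conic_form (cycle_point b x y) w = m * ((w - x) * (w - y)).
Proof.
move=> [xz yz xy E1 E2] S0; set t := cycle_point b x y.
have zx k : z k - x != 0 by rewrite subr_eq0 eq_sym.
have zy k : z k - y != 0 by rewrite subr_eq0 eq_sym.
have xzn k : x - z k != 0 by rewrite subr_eq0.
have yzn k : y - z k != 0 by rewrite subr_eq0.
have Qx : conic_form t x = 0.
  rewrite -[RHS]E2; apply: eq_bigr => j _; rewrite /t /cycle_point; field.
  by rewrite zx zy yzn.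
have Qy : conic_form t y = 0.
  rewrite -[RHS]E1; apply: eq_bigr => j _; rewrite /t /cycle_point; field.
  by rewrite zx zy xzn.
have SE : \sum_i b i =
  \sum_j t j * z j ^+ 2 - (x + y) * (\sum_j t j * z j) + x * y * \sum_j t j.
  rewrite !mulr_sumr -sumrB -big_split; apply: eq_bigr => i _ /=.
  rewrite /t /cycle_point; field.
  by rewrite zx zy.
move: Qx Qy SE; rewrite !conic_formE.
set m0 := \sum_j t j; set m1 := \sum_j t j * z j; set m2 := \sum_j t j * z j ^+ 2.
move=> Qx Qy SE.
have xyn : x - y != 0 by rewrite subr_eq0.
have m1E : m0 * (x + y) - 2 * m1 = 0.
  apply: (mulfI xyn); rewrite mulr0 -[RHS](subrr 0) -{1}Qx -Qy; ring.
have m2E : m2 - m0 * (x * y) = 0.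
  transitivity ((m0 * x ^+ 2 - 2 * m1 * x + m2) - x * (m0 * (x + y) - 2 * m1)).
    by ring.
  by rewrite Qx m1E mulr0 subr0.
exists m0 => [|w].
  apply: contra_neq S0 => m00; move: m1E m2E SE; rewrite m00 !mul0r !subr0 sub0r.
  move/eqP; rewrite oppr_eq0 mulf_eq0 pnatr_eq0 /= => /eqP -> ->.
  by rewrite !mulr0 subrr addr0.
rewrite conic_formE -/m0 -/m1 -/m2.
transitivity (m0 * ((w - x) * (w - y)) + (w * (m0 * (x + y) - 2 * m1)
  + (m2 - m0 * (x * y)))); first by ring.
by rewrite m1E m2E mulr0 !addr0.
Qed.

Lemma cycle_point_critical b x y : two_cycle z b x y -> good_weights z b ->
  conic_critical b (cycle_point b x y).
Proof.
move=> cxy [b0 S0 _ _]; have [m m0 mE] := conic_form_cycle_point cxy S0.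
have [xz yz _ _ _] := cxy.
have zx k : z k - x != 0 by rewrite subr_eq0 eq_sym.
have zy k : z k - y != 0 by rewrite subr_eq0 eq_sym.
have tQ i : cycle_point b x y i * conic_form (cycle_point b x y) (z i) = m * b i.
  by rewrite mE /cycle_point; field; rewrite zx zy.
have TE : conic_energy (cycle_point b x y) = m * \sum_i b i.
  by rewrite mulr_sumr; apply: eq_bigr => i _.
split=> [i||i]; last by rewrite TE tQ; ring.
  by rewrite /cycle_point !mulf_neq0 ?invr_neq0 ?mulf_neq0.
by rewrite TE mulf_neq0.
Qed.

(** The roots of [conic_form t] are the two-cycle.  Its degree is exactly two:
    a linear [conic_form t] would correspond to a cycle through infinity, which
    [cycle_lead_eq0] excludes. *)
Lemma critical_two_cycle b t : good_weights z b -> conic_critical b t ->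
  exists x y mu, [/\ two_cycle z b x y, mu != 0 &
    forall i, t i = mu * cycle_point b x y i].
Proof.
move=> gb [t0 T0 tE]; have [b0 S0 _ L0] := gb.
set S := \sum_k b k in S0 tE; set T := conic_energy t in T0 tE.
have Q0 i : conic_form t (z i) != 0.
  apply/eqP => q; have /eqP := tE i; rewrite q !mulr0 eq_sym mulf_eq0.
  by rewrite (negPf T0) (negPf (b0 i)).
have bE i : b i = S / T * (t i * conic_form t (z i)).
  by rewrite mulrAC tE mulrC mulKf.
set m0 := \sum_j t j; set m1 := \sum_j t j * z j; set m2 := \sum_j t j * z j ^+ 2.
have QE w : conic_form t w = m0 * w ^+ 2 - 2 * m1 * w + m2 := conic_formE t w.
have TE : T = 2 * (m0 * m2 - m1 ^+ 2) := conic_energyE t.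
have ST0 : S / T != 0 by rewrite mulf_neq0 ?invr_neq0.
(* If the leading coefficient [m0] vanished, the other root would be infinity. *)
have m0n : m0 != 0.
  apply/eqP => m00; have m1n : m1 != 0.
    by apply: contra_neq T0 => m10; rewrite TE m00 m10 mul0r expr0n subrr mulr0.
  (* [x] is the finite root; its partner is infinity, so [node_comb] vanishes at
     [x] and infinity is mapped back to [x]. *)
  pose x := m2 / (2 * m1).
  have QE' w : conic_form t w = - (2 * m1) * (w - x).
    by rewrite QE m00 /x; field.
  have zx i : x - z i != 0.
    apply: contra_neq (Q0 i) => xz.
    by rewrite QE' -opprB xz oppr0 mulr0.
  move/eqP: L0; apply; apply: (cycle_lead_eq0 (x := x)).
    transitivity (S / T * (2 * m1) * (\prod_j (x - z j)) * m0); last by rewrite m00 mulr0.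
    rewrite /m0 mulr_sumr; apply: eq_bigr => i _.
    rewrite bE QE' -(node_prod_mul z i); ring.
  pose k := S / T * (2 * m1).
  transitivity (k * m2 - 2 * k * x * m1 + k * x ^+ 2 * m0).
    rewrite -sum_quadratic; apply: eq_bigr => i _; rewrite bE QE' /k; ring.
  by rewrite m00 /x; field.
pose D := sqrtC (m1 ^+ 2 - m0 * m2).
have D2 : D ^+ 2 = m1 ^+ 2 - m0 * m2 by rewrite sqrtCK.
have D0 : D != 0.
  apply: contra_neq T0 => D0; rewrite TE -opprB -D2 D0 expr0n oppr0 mulr0 //.
pose x := (m1 + D) / m0; pose y := (m1 - D) / m0.
have Qxy w : conic_form t w = m0 * ((w - x) * (w - y)).
  have -> : m0 * ((w - x) * (w - y)) = m0 * w ^+ 2 - 2 * m1 * w + (m1 ^+ 2 - D ^+ 2) / m0.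
    by rewrite /x /y; field.
  by rewrite QE D2; field.
have zx i : z i - x != 0.
  by apply: contra_neq (Q0 i) => e; rewrite Qxy e mul0r mulr0.
have zy i : z i - y != 0.
  by apply: contra_neq (Q0 i) => e; rewrite Qxy e !mulr0.
have xz i : x - z i != 0 by rewrite -opprB oppr_eq0.
have yz i : y - z i != 0 by rewrite -opprB oppr_eq0.
exists x, y, (T / (S * m0)); split.
- split=> [i|i|||].
  + by rewrite -subr_eq0.
  + by rewrite -subr_eq0.
  + rewrite -subr_eq0 (_ : x - y = 2 * D / m0); last by rewrite /x /y; field.
    by rewrite !mulf_neq0 ?invr_neq0 ?pnatr_eq0.
  + transitivity (S / T * m0 * conic_form t y); last by rewrite Qxy subrr !mulr0.
    rewrite mulr_sumr; apply: eq_bigr => i _; rewrite bE Qxy; field.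
    by rewrite T0 xz.
  + transitivity (S / T * m0 * conic_form t x); last by rewrite Qxy subrr mul0r !mulr0.
    rewrite mulr_sumr; apply: eq_bigr => i _; rewrite bE Qxy; field.
    by rewrite T0 yz.
- by rewrite !mulf_neq0 ?invr_neq0 ?mulf_neq0.
by move=> i; rewrite /cycle_point bE Qxy; field; rewrite T0 S0 m0n zx zy.
Qed.
Lemma generic_weights : exists2 g : {mpoly F[d]}, g != 0 &
  forall b, g.@[b] != 0 -> good_weights z b /\
    coprimep (cycle_poly z b) (cycle_poly z b)^`().
Proof.
have /Bezout_coprimepP[[u v] /= /eqpP[[e e'] /= /andP[e0 e'0] eE]] :=
  generic_cycle_poly_separable hd z_inj.
exists (good_locus z * (e * e')).
  by rewrite mulf_neq0 ?good_locus_neq0 ?mulf_neq0.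
move=> b; rewrite mevalM mulf_eq0 negb_or => /andP[/good_locusP gb].
rewrite mevalM mulf_eq0 negb_or => /andP[eb0 eb'0].
split=> //; apply/Bezout_coprimepP.
pose ev := map_poly (meval b).
have eE' : ev (e *: (u * generic_cycle_poly z + v * (generic_cycle_poly z)^`())) = ev (e' *: 1).
  by rewrite eE.
move: eE'; rewrite /ev !map_polyZ rmorphD !rmorphM rmorph1 /= -deriv_map.
rewrite map_generic_cycle_poly -/ev => eE'.
exists (ev u, ev v) => /=; apply/eqpP; exists (e.@[b], e'.@[b]) => //=.
by rewrite eb0 eb'0.
Qed.

Lemma cycle_roots b : good_weights z b ->
  coprimep (cycle_poly z b) (cycle_poly z b)^`() ->
  exists rs, [/\ uniq rs, size rs = (d.-1 * d.-2)%N &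
    forall x, (x \in rs) = (cycle_form z b x == 0)].
Proof.
move=> gb; have L0 : cycle_lead z b != 0 by case: gb.
have [sp pL] := top_coef_cycle_poly z b.
have spE : size (cycle_poly z b) = (d.-1 * d.-2).+1.
  apply/eqP; rewrite eqn_leq sp /= ltnNge; apply/negP => sp'.
  by move: L0; rewrite -pL nth_default ?eqxx.
have [rs pE] := closed_field_poly_normal (cycle_poly z b).
have lc0 : lead_coef (cycle_poly z b) != 0.
  by rewrite lead_coef_eq0 -size_poly_gt0 spE.
rewrite {1 2}pE derivZ coprimepZl // coprimepZr // => cop.
exists rs; split.
- by rewrite -separable_prod_XsubC separable_poly.unlock.
- by apply: succn_inj; rewrite -spE pE size_scale // size_prod_XsubC.
- move=> x; rewrite -horner_cycle_poly -[RHS]/(root _ x) {1}pE rootZ //.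
  by rewrite root_prod_XsubC.
Qed.

(** Proportional solutions give the same [conic_form] up to scaling and hence
    the same unordered pair of roots, so solutions up to scaling are counted by
    half of the roots of [cycle_form]. *)
Theorem conic_critical_count : exists2 g : {mpoly F[d]}, g != 0 &
  forall b, g.@[b] != 0 -> exists rep : nat -> 'I_d -> F,
  [/\ forall k, (k < 'C(d - 1, 2))%N -> conic_critical b (rep k),
   forall k l mu, (k < 'C(d - 1, 2))%N -> (l < 'C(d - 1, 2))%N ->
     (forall i, rep k i = mu * rep l i) -> k = l &
   forall t, conic_critical b t -> exists k mu, [/\ (k < 'C(d - 1, 2))%N,
     mu != 0 & forall i, t i = mu * rep k i]].
Proof.
have [g g0 gP] := generic_weights; exists g => // b /gP[gb cop].
have [rs [urs srs rsP]] := cycle_roots gb cop.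
have S0 : \sum_i b i != 0 by case: gb.
pose phi := cycle_step z b.
have rsC x : x \in rs -> two_cycle z b x (phi x).
  by rewrite rsP => /eqP; exact: root_two_cycle.
have orb x : x \in rs -> [/\ phi x \in rs, phi (phi x) = x & phi x != x].
  move=> xrs; have [_ _ xphi _ _] := rsC x xrs.
  move: xrs; rewrite rsP => /eqP/(cycle_step_root z_inj gb)[px ppx].
  by split=> //; [rewrite rsP px | rewrite eq_sym].
have [r [ur sr r_rs r_cover r_half]] := half_orbits urs orb.
have rN : size r = 'C(d - 1, 2).
  apply: double_inj; rewrite sr srs subn1 -muln2 -[2%N]/(2`!)%N bin_ffact.
  by rewrite ffactnS ffactn1.
pose pt k := r`_k.
have ptr k : (k < 'C(d - 1, 2))%N -> pt k \in r by rewrite -rN => ?; exact: mem_nth.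
exists (fun k => cycle_point b (pt k) (phi (pt k))); split.
- by move=> k /ptr/r_rs/rsC ck; exact: cycle_point_critical.
- move=> k l mu kN lN kl.
  have ck := rsC _ (r_rs _ (ptr k kN)); have cl := rsC _ (r_rs _ (ptr l lN)).
  have [mk mk0 Qk] := conic_form_cycle_point ck S0.
  have [ml ml0 Ql] := conic_form_cycle_point cl S0.
  have [tk0 _ _] := cycle_point_critical ck gb.
  have i0 : 'I_d by exact: Ordinal hd.
  have mu0 : mu != 0 by apply: contra_neq (tk0 i0) => m0; rewrite kl m0 mul0r.
  have /eqP := conic_formZ (pt k) kl; rewrite Qk subrr mul0r mulr0 Ql eq_sym.
  rewrite !mulf_eq0 (negPf mu0) (negPf ml0) !subr_eq0 /= => /orP[/eqP e|/eqP e].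
    by apply/eqP; rewrite -(nth_uniq 0 _ _ ur) ?rN //; apply/eqP.
  by have := r_half _ (ptr l lN); rewrite -e ptr.
move=> t /(critical_two_cycle gb)[x [y [mu [cxy mu0 tE]]]].
have [x0 yE] := two_cycle_root gb cxy.
have xrs : x \in rs by rewrite rsP x0.
have [_ ppx _] := orb x xrs.
case/orP: (r_cover x xrs) => [xr|yr].
  exists (index x r), mu; rewrite -rN index_mem xr; split => // i.
  by rewrite tE yE /pt nth_index.
exists (index (phi x) r), mu; rewrite -rN index_mem yr; split => // i.
rewrite tE yE /pt nth_index // ppx /cycle_point [X in _ / X]mulrC //.
Qed.
End Weighted.

(** * Matrices of rank three *)

Section RankThree.
Variables (F : numClosedFieldType) (d : nat) (C : 'M[F]_d).
Hypotheses (C_sym : forall i j, C i j = C j i) (C_diag : forall i, C i i = 0).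
Hypothesis C_off : forall i j, i != j -> C i j != 0.
Hypothesis C_rank : \rank C = 3%N.
Variables i0 i1 i2 : 'I_d.
Hypotheses (n01 : i0 != i1) (n02 : i0 != i2) (n12 : i1 != i2).

Local Notation p := (C i0 i1).
Local Notation q := (C i0 i2).
Local Notation r := (C i1 i2).

Let p0 : p != 0. Proof. exact: C_off. Qed.
Let q0 : q != 0. Proof. exact: C_off. Qed.
Let r0 : r != 0. Proof. exact: C_off. Qed.

(** The rows [i0], [i1], [i2] are independent because the principal minor on
    these indices is [2 * p * q * r]. *)
Lemma row_combination j : exists x y w, forall k,
  C j k = x * C i0 k + y * C i1 k + w * C i2 k.
Proof.
pose f (l : 'I_3) := if l == 0%N :> nat then i0 else if l == 1%N :> nat then i1 else i2.
have mulE (v : 'rV_3) k : (v *m rowsub f C) 0 k =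
    v 0 0 * C i0 k + v 0 1 * C i1 k + v 0 2 * C i2 k.
  rewrite mxE !big_ord_recl big_ord0 !mxE addr0 addrA.
  by congr (_ + _ * _ + _ * _); congr (v 0 _); apply: val_inj.
have sub : (rowsub f C <= C)%MS.
  by apply/row_subP => l; rewrite row_rowsub; exact: row_sub.
have free : row_free (rowsub f C).
  apply: inj_row_free => v v0.
  have vk k : v 0 0 * C i0 k + v 0 1 * C i1 k + v 0 2 * C i2 k = 0.
    by rewrite -mulE v0 mxE.
  have := vk i0; have := vk i1; have := vk i2.
  rewrite !C_diag !mulr0 !addr0 !add0r [C i1 i0]C_sym [C i2 i0]C_sym [C i2 i1]C_sym.
  move=> e2 e1 e0.
  have z0 : v 0 0 = 0.
    apply: (mulfI p0); apply: (mulfI q0); apply: (mulfI (x := 2)); first by rewrite pnatr_eq0.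
    transitivity (p * (v 0 0 * q + v 0 1 * r) + q * (v 0 0 * p + v 0 2 * r)
      - r * (v 0 1 * p + v 0 2 * q)); first by ring.
    by rewrite e0 e1 e2; ring.
  have z1 : v 0 1 = 0.
    by move/eqP: e2; rewrite z0 mul0r add0r mulf_eq0 (negPf r0) orbF => /eqP.
  have z2 : v 0 2 = 0.
    by move/eqP: e1; rewrite z0 mul0r add0r mulf_eq0 (negPf r0) orbF => /eqP.
  apply/rowP => l; rewrite mxE.
  have [l0|[l1|l2]] : l = 0 \/ (l = 1 \/ l = 2).
  - by case: l => -[|[|[|//]]] lt; [left|right; left|right; right]; apply: val_inj.
  - by rewrite l0.
  - by rewrite l1.
  - by rewrite l2.
have : (C <= rowsub f C)%MS.
  by rewrite -(mxrank_leqif_sup sub).2 C_rank (eqP free).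
move/row_subP/(_ j)/submxP => [v vE].
exists (v 0 0), (v 0 1), (v 0 2) => k.
by rewrite -mulE -vE mxE.
Qed.

Local Notation a j := (r * C i0 j).
Local Notation b j := (q * C i1 j).
Local Notation e j := (p * C i2 j).

(** The matrix is recovered from the three rows [i0], [i1], [i2] through the
    inverse of their principal block. *)
Lemma rank3_gram j k : 2 * p * q * r * C j k =
  a k * (b j + e j - a j) + b k * (a j + e j - b j) + e k * (a j + b j - e j).
Proof.
have [x [y [w h]]] := row_combination j.
have e0 := h i0; have e1 := h i1; have e2 := h i2.
rewrite C_diag [C i1 i0]C_sym [C i2 i0]C_sym in e0.
rewrite C_diag [C i2 i1]C_sym in e1.
rewrite C_diag in e2.
by rewrite h [C i0 j]C_sym [C i1 j]C_sym [C i2 j]C_sym e0 e1 e2 /=; ring.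
Qed.

Let zz j := (a j - b j + e j) / (2 * e j).

Let e_neq0 j : j != i2 -> e j != 0.
Proof. by move=> j2; rewrite mulf_neq0 // C_sym C_off. Qed.

(** Isotropy [C j j = 0] makes [(a j, b j, e j)] a point of the conic
    [a^2 + b^2 + e^2 = 2 * (a * b + a * e + b * e)], which is parametrised by
    [(zz^2, (zz - 1)^2, 1)].  The indices [i0], [i1], [i2] sit at [0], [1] and
    infinity. *)
Lemma rank3_param j : j != i2 -> a j = e j * zz j ^+ 2 /\ b j = e j * (zz j - 1) ^+ 2.
Proof.
move=> j2; have cj : C i2 j != 0 by rewrite C_off // eq_sym.
have ej : e j != 0 by rewrite mulf_neq0.
have := rank3_gram j j; rewrite C_diag mulr0 => /esym g.
have aE : a j = e j * zz j ^+ 2.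
  apply: (mulfI (x := 4 * e j)); first by rewrite mulf_neq0 ?pnatr_eq0.
  transitivity ((a j - b j + e j) ^+ 2 + (a j * (b j + e j - a j) +
    b j * (a j + e j - b j) + e j * (a j + b j - e j))).
    by ring.
  by rewrite g addr0 /zz; field; rewrite cj p0.
split=> //; transitivity (a j + e j - 2 * e j * zz j); last by rewrite aE; ring.
by rewrite /zz; field; rewrite cj p0.
Qed.

Lemma rank3_affine j k : j != i2 -> k != i2 ->
  p * q * r * C j k = e j * e k * (zz j - zz k) ^+ 2.
Proof.
move=> /rank3_param[aj bj] /rank3_param[ak bk].
apply: (mulfI (x := 2)); first by rewrite pnatr_eq0.
transitivity (2 * p * q * r * C j k); first by ring.
by rewrite rank3_gram aj bj ak bk; ring.
Qed.

(** The affine coordinate [zz] puts [i2] at infinity; inverting it around a point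
    [om] that is not used makes all coordinates finite. *)
Lemma rank3_conic : exists z lam : 'I_d -> F, [/\ injective z,
  forall i, lam i != 0 & forall i j, C i j = lam i * lam j * (z i - z j) ^+ 2].
Proof.
(* Any number of absolute value larger than all the coordinates will do. *)
have [om omz] : exists om, forall j, zz j - om != 0.
  exists (\sum_j `|zz j| + 1) => j; rewrite subr_eq0; apply/eqP => zE.
  have : `|zz j| < \sum_j `|zz j| + 1.
    rewrite (bigD1 j) //= -addrA ltrDl ltr_wpDl // sumr_ge0 //.
  by rewrite {1}zE ger0_norm ?ltxx // addr_ge0 // sumr_ge0.
pose s := sqrtC (p * q * r).
have s2 : s ^+ 2 = p * q * r by rewrite sqrtCK.
have s0 : s != 0 by rewrite sqrtC_eq0 !mulf_neq0.
pose z j := if j == i2 then 0 else (zz j - om)^-1.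
pose lam j := if j == i2 then s / p else e j * (zz j - om) ^+ 2 / s.
have lam0 j : lam j != 0.
  rewrite /lam; case: ifPn => j2; first by rewrite mulf_neq0 ?invr_neq0.
  by rewrite mulf_neq0 ?invr_neq0 // mulf_neq0 ?expf_neq0 // e_neq0.
have CE i j : C i j = lam i * lam j * (z i - z j) ^+ 2.
  have E2 k : C i2 k = lam i2 * lam k * (z i2 - z k) ^+ 2.
    have [->|k2] := eqVneq k i2; first by rewrite C_diag subrr expr0n mulr0.
    rewrite /lam /z eqxx (negPf k2); field.
    by rewrite s0 p0 omz.
  have [->//|ni2] := eqVneq i i2.
  have [->|nj2] := eqVneq j i2; first by rewrite C_sym E2; ring.
  rewrite /lam /z (negPf ni2) (negPf nj2).
  apply: (mulfI (x := p * q * r)); first by rewrite !mulf_neq0.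
  rewrite rank3_affine // -s2; field.
  by rewrite s0 !omz.
exists z, lam; split=> // i j zij; apply/eqP; apply: contraT => /C_off.
by rewrite CE zij subrr expr0n mulr0 eqxx.
Qed.
End RankThree.

(** * Vectors indexed by pairs as symmetric matrices *)

Section PairSum.
Variable d : nat.
Local Notation fst_of k := (val (@pair_of d k)).1.
Local Notation snd_of k := (val (@pair_of d k)).2.

(** Sums over unordered pairs become double sums over indices; the summation
    form of the definition keeps it additive in [f] and free of case distinctions. *)
Definition pair_mx (V : nmodType) (f : 'I_(npairs d) -> V) (i j : 'I_d) : V :=
  \sum_k f k *+ ((val (pair_of k) == (i, j)) + (val (pair_of k) == (j, i))).

Lemma fst_lt_snd k : (fst_of k < snd_of k)%N.
Proof. exact: valP (pair_of k). Qed.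

Lemma pair_mxC (V : nmodType) (f : 'I_(npairs d) -> V) i j : pair_mx f i j = pair_mx f j i.
Proof. by apply: eq_bigr => k _; rewrite addnC. Qed.

Lemma pair_mx_diag (V : nmodType) (f : 'I_(npairs d) -> V) i : pair_mx f i i = 0.
Proof.
rewrite /pair_mx big1 // => k _; case: eqP => [e|_]; last by rewrite mulr0n.
by have := fst_lt_snd k; rewrite e ltnn.
Qed.

Lemma pair_mx_pair (V : nmodType) (f : 'I_(npairs d) -> V) k :
  pair_mx f (fst_of k) (snd_of k) = f k.
Proof.
rewrite /pair_mx (bigD1 k) //= -surjective_pairing eqxx big1 => [|l lk].
  rewrite (_ : (_ == _) = false) ?addn0 ?mulr1n ?addr0 //.
  apply/eqP => /(congr1 fst) e; have e' : fst_of k = snd_of k by exact: e.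
  by have := fst_lt_snd k; rewrite e' ltnn.
rewrite (_ : (_ == val (pair_of k)) = false); last first.
  by rewrite (inj_eq val_inj) (inj_eq enum_val_inj) (negPf lk).
rewrite (_ : (_ == _) = false) ?mulr0n //.
apply/eqP => e; have := fst_lt_snd k; have := fst_lt_snd l.
have -> : fst_of l = snd_of k by exact: (congr1 fst e).
have -> : snd_of l = fst_of k by exact: (congr1 snd e).
by move=> /ltnW; rewrite leqNgt => /negPf->.
Qed.

Lemma edgeP i j : i != j -> exists k,
  (val (@pair_of d k) = (i, j) \/ val (@pair_of d k) = (j, i)) /\
  forall (V : nmodType) (f : 'I_(npairs d) -> V), pair_mx f i j = f k.
Proof.
wlog ij : i j / (i < j)%N => [h nij|_].
  have [lt|gt|e] := ltngtP i j; first exact: h.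
    have [|k [kE fE]] := h j i gt; first by rewrite eq_sym.
    exists k; split=> [|V f]; first by case: kE; [right|left].
    by rewrite pair_mxC.
  by move: nij; rewrite -val_eqE /= e eqxx.
pose e : pairs d := exist _ (i, j) ij.
have ek : pair_of (enum_rank e) = e by rewrite /pair_of enum_rankK.
exists (enum_rank e); split; first by left; rewrite ek.
by move=> V f; have := pair_mx_pair f (enum_rank e); rewrite ek.
Qed.

Lemma sum_pair_mx (A : comNzRingType) (f : 'I_(npairs d) -> A) (a : 'I_d -> A) :
  \sum_k f k * (a (fst_of k) + a (snd_of k)) =
  \sum_i a i * \sum_j pair_mx f i j.
Proof.
under [RHS]eq_bigr do rewrite mulr_sumr.
rewrite pair_big /=; under [RHS]eq_bigr do rewrite mulr_sumr.
rewrite exchange_big /=; apply: eq_bigr => k _.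
under [RHS]eq_bigr do rewrite mulrnAr mulrnDr.
rewrite big_split /= mulrDr; congr (_ + _).
  rewrite (bigD1 (val (pair_of k))) //= -surjective_pairing eqxx big1 ?addr0 ?mulr1n 1?mulrC //.
  by move=> [i j] /=; rewrite eq_sym => /negPf->; rewrite mulr0n.
rewrite (bigD1 (snd_of k, fst_of k)) //= -surjective_pairing eqxx big1 ?addr0 ?mulr1n 1?mulrC //.
move=> [i j] /= ij; case: eqP => [e|]; rewrite ?mulr0n //.
by move: ij; rewrite e eqxx.
Qed.
End PairSum.

(** * Torus points and tangent spaces of the scaled toric variety *)

Section Toric.
Variables (R : realType) (d : nat) (c : pairs d -> R[i]).
Hypotheses (hd : (3 <= d)%N) (c0 : is_scaling c).
Local Notation C := R[i].
Local Notation N := (npairs d).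
Local Notation fst_of k := (val (@pair_of d k)).1.
Local Notation snd_of k := (val (@pair_of d k)).2.
Implicit Types (t a : 'I_d -> C) (x y v u : 'rV[C]_N) (f : {mpoly C[N]}).
Local Notation Cm := (pair_mx (fun k => c (pair_of k))).
Local Notation xm x := (pair_mx (fun k => x 0 k)).
Local Notation V := (scaled_toric_variety c).
Local Notation torus := [set t : 'I_d -> C | forall i, t i != 0]%classic.
Local Notation M := [set monomial_point c t | t in torus]%classic.

Lemma scaling_mx_neq0 i j : i != j -> Cm i j != 0.
Proof. by move=> /edgeP[k [_ ->]]. Qed.

Lemma monomial_point_mx t i j : i != j ->
  xm (monomial_point c t) i j = Cm i j * t i * t j.
Proof.
move=> /edgeP[k [kE fE]]; rewrite !fE mxE.
by case: kE => -> //=; rewrite mulrAC.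
Qed.

Lemma eq_pair_row x y : (forall i j, i != j -> xm x i j = xm y i j) -> x = y.
Proof.
move=> h; apply/rowP => k; have := h (fst_of k) (snd_of k).
rewrite (pair_mx_pair (fun l => x 0 l)) (pair_mx_pair (fun l => y 0 l)); apply.
by apply/eqP => e; have := fst_lt_snd k; rewrite e ltnn.
Qed.

Lemma monomial_pointE t k :
  monomial_point c t 0 k = c (pair_of k) * t (fst_of k) * t (snd_of k).
Proof. by rewrite mxE. Qed.

Lemma monomial_point_neq0 t k : (forall i, t i != 0) -> monomial_point c t 0 k != 0.
Proof. by move=> t0; rewrite monomial_pointE !mulf_neq0 // c0. Qed.

Lemma npairs_gt0 : (0 < N)%N.
Proof.
have [i0 [i1 [i2 [n01 n02 n12]]]] := three_nodes hd.
by have [k _] := edgeP n01; exact: leq_ltn_trans (ltn_ord k).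
Qed.

Lemma monomial_point_in_variety t : (forall i, t i != 0) -> V (monomial_point c t).
Proof.
move=> t0; split=> [|f [_ f0]]; last by apply: f0; exists t.
apply: contraNneq (monomial_point_neq0 (Ordinal npairs_gt0) t0) => ->.
by rewrite mxE.
Qed.

Lemma homog_vanishing_closure f :
  homog_vanishing M f -> homog_vanishing V f.
Proof. by move=> fM; split=> [|x [_]]; [case: fM | apply]. Qed.

Local Notation Xm := (pair_mx (fun k => 'X_k : {mpoly C[N]})).

(** Both monomials have the same exponent as polynomials in [t]: each of [i] and
    [j] occurs once, [i1] and [i2] once and [i0] twice.  These cubics alone
    determine the torus points and their tangent spaces. *)
Definition star_binomial i0 i1 i2 i j : {mpoly C[N]} :=
  (Cm i0 i * Cm i0 j * Cm i1 i2) *: (Xm i j * Xm i0 i1 * Xm i0 i2) -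
  (Cm i j * Cm i0 i1 * Cm i0 i2) *: (Xm i0 i * Xm i0 j * Xm i1 i2).

Lemma meval_Xm x i j : i != j -> mevalr (Xm i j) x = xm x i j.
Proof. by move=> /edgeP[k [_ fE]]; rewrite !fE /mevalr mevalXU. Qed.

Lemma homog_Xm i j : i != j -> Xm i j \is 1.-homog.
Proof. by move=> /edgeP[k [_ ->]]; rewrite dhomogX /= mdeg1. Qed.

Section Binomial.
Variables i0 i1 i2 i j : 'I_d.
Hypotheses (n01 : i0 != i1) (n02 : i0 != i2) (n12 : i1 != i2).
Hypotheses (nij : i != j) (n0i : i0 != i) (n0j : i0 != j).

Lemma meval_star_binomial x : mevalr (star_binomial i0 i1 i2 i j) x =
  Cm i0 i * Cm i0 j * Cm i1 i2 * (xm x i j * xm x i0 i1 * xm x i0 i2) -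
  Cm i j * Cm i0 i1 * Cm i0 i2 * (xm x i0 i * xm x i0 j * xm x i1 i2).
Proof.
by rewrite -!meval_Xm // /mevalr mevalB !mevalZ !mevalM.
Qed.

Lemma star_binomial_vanishing : homog_vanishing V (star_binomial i0 i1 i2 i j).
Proof.
apply: homog_vanishing_closure; split.
  exists 3%N; rewrite rpredB // dhomogZ // -[3%N]/(1 + 1 + 1)%N !dhomogM //;
  exact: homog_Xm.
move=> _ [t t0 <-]; rewrite meval_star_binomial !monomial_point_mx //; ring.
Qed.
End Binomial.

(** With [y_ij = x_ij / c_ij], the value [t_i0] is forced up to sign by
    [y01 * y02 = t_i0^2 * y12], and the other [t_i] by [y_0i = t_i0 * t_i].  The
    binomials then give the remaining coordinates. *)
Lemma torus_point x : V x -> (forall k, x 0 k != 0) ->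
  exists2 t, (forall i, t i != 0) & x = monomial_point c t.
Proof.
move=> Vx x0; have [i0 [i1 [i2 [n01 n02 n12]]]] := three_nodes hd.
have xm0 i j : i != j -> xm x i j != 0 by move=> /edgeP[k [_ ->]].
have [y yE] : exists y : 'I_d -> 'I_d -> C,
    forall i j, i != j -> xm x i j = Cm i j * y i j.
  exists (fun i j => xm x i j / Cm i j) => i j ij.
  by rewrite mulrCA divff ?mulr1 // scaling_mx_neq0.
have y0 i j : i != j -> y i j != 0.
  by move=> ij; apply: contra_neq (xm0 i j ij) => yij; rewrite yE // yij mulr0.
pose t0 := sqrtC (y i0 i1 * y i0 i2 / y i1 i2).
have t02 : t0 ^+ 2 = y i0 i1 * y i0 i2 / y i1 i2 by rewrite sqrtCK.
have t0n : t0 != 0 by rewrite sqrtC_eq0 !mulf_neq0 ?invr_neq0 ?y0.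
pose t i := if i == i0 then t0 else y i0 i / t0.
exists t => [i|].
  rewrite /t; case: ifPn => // ni; rewrite mulf_neq0 ?invr_neq0 // y0 //.
  by rewrite eq_sym.
apply: eq_pair_row => i j nij; rewrite monomial_point_mx // /t.
have [ii|ni] := eqVneq i i0; have [jj|nj] := eqVneq j i0.
- by move: nij; rewrite ii jj eqxx.
- by rewrite ii yE 1?eq_sym //; field.
- have nji : j != i by rewrite eq_sym.
  by rewrite jj pair_mxC [Cm i _]pair_mxC -jj yE // jj; field.
have n0i : i0 != i by rewrite eq_sym.
have n0j : i0 != j by rewrite eq_sym.
have /eqP := (star_binomial_vanishing n01 n02 n12 nij n0i n0j).2 x Vx.
rewrite meval_star_binomial // subr_eq0 !yE // => /eqP E.
have nz : Cm i0 i * Cm i0 j * Cm i1 i2 * Cm i0 i1 * Cm i0 i2 != 0.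
  by rewrite !mulf_neq0 ?scaling_mx_neq0.
have yy : y i j * y i0 i1 * y i0 i2 = y i0 i * y i0 j * y i1 i2.
  apply: (mulfI (mulf_neq0 nz (scaling_mx_neq0 nij))).
  transitivity (Cm i0 i * Cm i0 j * Cm i1 i2 * (Cm i j * y i j *
    (Cm i0 i1 * y i0 i1) * (Cm i0 i2 * y i0 i2))); first by ring.
  by rewrite E; ring.
transitivity (Cm i j * (y i0 i * y i0 j) / t0 ^+ 2); last by field.
rewrite t02; apply: (mulIf (y0 _ _ n01)); apply: (mulIf (y0 _ _ n02)).
transitivity (Cm i j * (y i j * y i0 i1 * y i0 i2)); first by ring.
by rewrite yy; field; rewrite !y0.
Qed.

Section Tangent.
Variable x v : 'rV[C]_N.
Definition dir_deriv f : C := \sum_k mevalr f^`M(k) x * v 0 k.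

Lemma dir_derivM f g :
  dir_deriv (f * g) = dir_deriv f * mevalr g x + mevalr f x * dir_deriv g.
Proof.
rewrite /dir_deriv mulr_suml mulr_sumr -big_split; apply: eq_bigr => k _ /=.
by rewrite mderivM /mevalr mevalD !mevalM mulrDl mulrAC -[X in _ + X]mulrA.
Qed.

Lemma dir_derivZ (s : C) f : dir_deriv (s *: f) = s * dir_deriv f.
Proof.
rewrite /dir_deriv mulr_sumr; apply: eq_bigr => k _.
by rewrite mderivZ /mevalr mevalZ mulrA.
Qed.

Lemma dir_derivB f g : dir_deriv (f - g) = dir_deriv f - dir_deriv g.
Proof.
rewrite /dir_deriv -sumrB; apply: eq_bigr => k _.
by rewrite mderivB /mevalr mevalB mulrBl.
Qed.

Lemma dir_derivX k : dir_deriv 'X_k = v 0 k.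
Proof.
rewrite /dir_deriv (bigD1 k) //= big1 => [|l lk].
  rewrite mderivX mnmE eqxx scale1r -{1}[U_(k)%MM]add0m addmK mpolyX0.
  by rewrite /mevalr meval1 mul1r addr0.
by rewrite mderivX mnmE eq_sym (negPf lk) scale0r /mevalr meval0 mul0r.
Qed.

Lemma dir_deriv_Xm i j : i != j -> dir_deriv (Xm i j) = xm v i j.
Proof. by move=> /edgeP[k [_ fE]]; rewrite !fE dir_derivX. Qed.
End Tangent.

(** In logarithmic coordinates [w_ij = v_ij / x_ij] the differential of
    [star_binomial] says
    [w_ij + w_01 + w_02 = w_0i + w_0j + w_12], the additive form of the equations
    in [torus_point], solved in the same way. *)
Lemma cone_tangent_torus t v : (forall i, t i != 0) ->
  cone_tangent V (monomial_point c t) v ->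
  exists a, forall k, v 0 k = monomial_point c t 0 k * (a (fst_of k) + a (snd_of k)).
Proof.
move=> t0; set x := monomial_point c t => tv.
have [i0 [i1 [i2 [n01 n02 n12]]]] := three_nodes hd.
have x0 k : x 0 k != 0 by exact: monomial_point_neq0.
have xm0 i j : i != j -> xm x i j != 0 by move=> /edgeP[k [_ ->]].
pose w i j := xm v i j / xm x i j.
have vE i j : i != j -> xm v i j = xm x i j * w i j.
  by move=> ij; rewrite /w mulrCA divff ?mulr1 // xm0.
have wC i j : w i j = w j i by rewrite /w pair_mxC [xm x i j]pair_mxC.
pose a0 := (w i0 i1 + w i0 i2 - w i1 i2) / 2.
pose a i := if i == i0 then a0 else w i0 i - a0.
have two : 2 != 0 :> C by rewrite pnatr_eq0.
have wE i j : i != j -> w i j = a i + a j.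
  move=> nij; rewrite /a.
  have [ii|ni] := eqVneq i i0; have [jj|nj] := eqVneq j i0.
  - by move: nij; rewrite ii jj eqxx.
  - by rewrite ii; ring.
  - by rewrite jj wC; ring.
  have n0i : i0 != i by rewrite eq_sym.
  have n0j : i0 != j by rewrite eq_sym.
  have := tv _ (star_binomial_vanishing n01 n02 n12 nij n0i n0j).
  rewrite -/(dir_deriv x v _) /star_binomial dir_derivB !dir_derivZ !dir_derivM.
  rewrite !dir_deriv_Xm // /mevalr !mevalM -!/(mevalr _ _) !meval_Xm // !vE //.
  rewrite !monomial_point_mx //.
  move=> E; have nz : Cm i0 i * Cm i0 j * Cm i1 i2 * Cm i0 i1 * Cm i0 i2 * Cm i j
     * (t i * t j * t i0 ^+ 2 * t i1 * t i2) != 0.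
    by rewrite !mulf_neq0 ?expf_neq0 ?scaling_mx_neq0.
  have E' : w i j + w i0 i1 + w i0 i2 - w i0 i - w i0 j - w i1 i2 = 0.
    by apply: (mulfI nz); rewrite mulr0 -E; ring.
  transitivity (w i j - (w i j + w i0 i1 + w i0 i2 - w i0 i - w i0 j - w i1 i2)).
    by rewrite E' subr0.
  by rewrite /a0; field.
exists a => k; have nk : fst_of k != snd_of k.
  by apply/eqP => e; have := fst_lt_snd k; rewrite e ltnn.
rewrite -wE // -[x 0 k](pair_mx_pair (fun l => x 0 l)) -vE //.
by rewrite (pair_mx_pair (fun l => v 0 l)).
Qed.

(** A polynomial vanishing on the variety vanishes along the curve
    [t_i * (1 + a_i * s)]; the chain rule at [s = 0] gives the claim. *)
Lemma torus_cone_tangent t a : (forall i, t i != 0) ->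
  cone_tangent V (monomial_point c t)
    (\row_k (monomial_point c t 0 k * (a (fst_of k) + a (snd_of k)))).
Proof.
move=> t0 f [_ fV]; set x := monomial_point c t.
pose l i : {poly C} := 1 + a i *: 'X.
pose g k : {poly C} := (x 0 k)%:P * (l (fst_of k) * l (snd_of k)).
have l0 i : (l i).[0] = 1 by rewrite /l !hornerE.
have g0 k : (g k).[0] = x 0 k by rewrite /g !hornerM hornerC !l0 !mulr1.
(* The curve leaves the torus where some [1 + a_i * s] vanishes; multiplying by
   their product gives a polynomial vanishing for every [s]. *)
have P0 : \prod_i l i != 0.
  apply/prodf_neq0 => i _; apply: contraTneq (oner_neq0 C) => li.
  by rewrite negbK -(l0 i) li horner0.
have G0 : mmap (@polyC C) g f = 0.
  apply/eqP; rewrite -(inj_eq (mulIf P0)) mul0r; apply/eqP/horner_eq0 => s.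
  rewrite hornerM horner_prod.
  have [z|/prodf_neq0 nz] := eqVneq (\prod_i (l i).[s]) 0; first by rewrite z mulr0.
  pose t' i := t i * (l i).[s].
  have t'0 i : t' i != 0 by rewrite mulf_neq0 // nz.
  have := fV _ (monomial_point_in_variety t'0); rewrite /mevalr horner_mmap.
  under meval_eq => k do rewrite monomial_pointE.
  move=> E; apply/eqP; rewrite mulf_eq0; apply/orP; left; apply/eqP.
  rewrite -[RHS]E; apply: meval_eq => k.
  by rewrite /g !hornerM hornerC /x monomial_pointE /t'; ring.
have := congr1 (fun q : {poly C} => q^`().[0]) G0.
rewrite /= deriv_mmap deriv0 horner0 horner_sum => E; rewrite -[RHS]E.
apply: eq_bigr => k _; rewrite hornerM horner_mmap mxE; congr (_ * _).
  by apply: meval_eq => j; rewrite g0.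
rewrite /g derivM derivC mul0r add0r derivM /l !derivD !derivZ !derivX !derivC.
by rewrite !hornerE /= addr0.
Qed.

(** * Critical equations *)

Definition marginal u i : C := \sum_j xm u i j.

Lemma sum_marginal u : \sum_i marginal u i = 2 * \sum_k u 0 k.
Proof.
have := sum_pair_mx (fun k => u 0 k) (fun=> 1).
under [RHS]eq_bigr do rewrite mul1r; move=> <-.
by rewrite mulr_sumr; apply: eq_bigr => k _; ring.
Qed.

Lemma marginal_monomial t i :
  marginal (monomial_point c t) i = t i * \sum_j Cm i j * t j.
Proof.
rewrite mulr_sumr; apply: eq_bigr => j _.
have [->|nij] := eqVneq i j; first by rewrite !pair_mx_diag mul0r mulr0.
by rewrite monomial_point_mx //; ring.
Qed.

Definition torus_critical (b : 'I_d -> C) t : Prop := [/\ forall i, t i != 0,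
  \sum_i t i * \sum_j Cm i j * t j != 0 &
  forall i, (\sum_k b k) * (t i * \sum_j Cm i j * t j) =
    (\sum_k t k * \sum_j Cm k j * t j) * b i].

Lemma sum_monomial t :
  2 * \sum_k monomial_point c t 0 k = \sum_i t i * \sum_j Cm i j * t j.
Proof. by rewrite -sum_marginal; apply: eq_bigr => i _; exact: marginal_monomial. Qed.

Lemma dlogL_torus u t a : (forall i, t i != 0) ->
  dlogL u (monomial_point c t)
    (\row_k (monomial_point c t 0 k * (a (fst_of k) + a (snd_of k)))) =
  \sum_i a i * (marginal u i - (\sum_k u 0 k) / (\sum_k monomial_point c t 0 k) *
     (t i * \sum_j Cm i j * t j)).
Proof.
move=> t0; rewrite /dlogL.
under eq_bigr => k _.
  rewrite mxE [_ / _]mulrAC divff ?monomial_point_neq0 // mul1r.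
  over.
under [X in _ * (X / _)]eq_bigr do rewrite mxE.
rewrite !sum_pair_mx.
under [RHS]eq_bigr do rewrite mulrBr.
rewrite sumrB; congr (_ - _).
rewrite mulrA mulrAC mulr_sumr; apply: eq_bigr => i _.
by rewrite -/(marginal (monomial_point c t) i) marginal_monomial; ring.
Qed.

(** The tangent space is spanned by the directions attached to the coordinate
    vectors [a], and [dlogL] is linear in [a] by [dlogL_torus]; both sides of the
    resulting equations are multiplied by two to turn sums over pairs into sums over
    the index set. *)
Lemma critical_pointP u x : \sum_k u 0 k != 0 ->
  [/\ V x, ~ in_H x & forall v, cone_tangent V x v -> dlogL u x v = 0] <->
  exists2 t, torus_critical (marginal u) t & x = monomial_point c t.
Proof.
move=> U0; have two : 2 != 0 :> C by rewrite pnatr_eq0.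
split=> [[Vx Hx xcrit]|[t [t0 T0 tE] ->]].
  move/eqP: Hx; rewrite mulf_eq0 negb_or => /andP[/prodf_neq0 x0 s0].
  have [|t t0 xE] := torus_point Vx; first by move=> k; exact: x0.
  exists t => //; rewrite xE in Vx x0 s0 xcrit; split => // [|i].
    by rewrite -sum_monomial mulf_neq0.
  pose a j : C := (j == i)%:R.
  have := xcrit _ (torus_cone_tangent a t0).
  rewrite dlogL_torus // (bigD1 i) //= /a eqxx mul1r [X in _ + X]big1 ?addr0 => [|j ji].
    move/eqP; rewrite subr_eq0 => /eqP ->; rewrite sum_marginal -sum_monomial.
    by field.
  by rewrite (negPf ji) mul0r.
have s0 : \sum_k monomial_point c t 0 k != 0.
  by apply: contra_neq T0 => s0; rewrite -sum_monomial s0 mulr0.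
split; first exact: monomial_point_in_variety.
  apply/eqP; rewrite mulf_neq0 //; apply/prodf_neq0 => k _.
  exact: monomial_point_neq0.
move=> v /(cone_tangent_torus t0)[a va].
have -> : v = \row_k (monomial_point c t 0 k * (a (fst_of k) + a (snd_of k))).
  by apply/rowP => k; rewrite mxE va.
rewrite dlogL_torus // big1 // => i _; apply/eqP; rewrite mulf_eq0 subr_eq0.
apply/orP; right; apply/eqP; have := tE i; rewrite sum_marginal -sum_monomial => E.
apply: (mulfI (mulf_neq0 two s0)); rewrite -E; field.
exact: s0.
Qed.

(** If [t_i * t_j = nu * t'_i * t'_j] for all [i <> j], comparing [(i, k)] with
    [(j, k)] for a third index [k] shows that [t_i / t'_i] does not depend on [i]. *)
Lemma monomial_point_line t t' : (forall i, t i != 0) -> (forall i, t' i != 0) ->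
  (<[monomial_point c t]> = <[monomial_point c t']>)%VS <->
  exists2 mu, mu != 0 & forall i, t i = mu * t' i.
Proof.
move=> t0 t'0; split=> [tt'|[mu mu0 tE]].
  have : monomial_point c t \in <[monomial_point c t']>%VS by rewrite -tt' memv_line.
  move/vlineP => [nu nuE].
  have tij i j : i != j -> t i * t j = nu * (t' i * t' j).
    move=> nij; apply: (mulfI (scaling_mx_neq0 nij)).
    have := monomial_point_mx t nij; rewrite mulrA => <-; rewrite nuE.
    have -> : xm (nu *: monomial_point c t') i j = nu * xm (monomial_point c t') i j.
      by have [k [_ kE]] := edgeP nij; rewrite !kE mxE.
    by rewrite monomial_point_mx //; ring.
  have ratio i j : t i / t' i = t j / t' j.
    have [->//|nij] := eqVneq i j.
    have [k /andP[ki kj]] : exists k, (k != i) && (k != j).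
      have [i0 [i1 [i2 [n01 n02 n12]]]] := three_nodes hd.
      have [e0|] := boolP ((i0 != i) && (i0 != j)); first by exists i0.
      have [e1|] := boolP ((i1 != i) && (i1 != j)); first by exists i1.
      have [e2|] := boolP ((i2 != i) && (i2 != j)); first by exists i2.
      rewrite !negb_and !negbK => /orP[]/eqP e2 /orP[]/eqP e1 /orP[]/eqP e0;
        move: n01 n02 n12; rewrite e0 e1 e2 ?eqxx //.
    have ik := tij i k; have jk := tij j k.
    apply: (mulIf (t0 k)); transitivity (nu * t' k).
      by rewrite mulrAC ik 1?eq_sym //; field.
    by rewrite mulrAC jk 1?eq_sym //; field.
  pose i0 : 'I_d := Ordinal (leq_trans (isT : 0 < 3)%N hd).
  exists (t i0 / t' i0); first by rewrite mulf_neq0 ?invr_neq0.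
  by move=> i; rewrite -(ratio i) divfK.
have E : monomial_point c t = mu ^+ 2 *: monomial_point c t'.
  by apply/rowP => k; rewrite !mxE !tE; ring.
have E' : monomial_point c t' = (mu ^- 2) *: monomial_point c t.
  by rewrite E scalerA mulVf ?scale1r // expf_neq0.
apply/eqP; rewrite eqEsubv -!memvE; apply/andP; split.
  by apply/vlineP; exists (mu ^+ 2).
by apply/vlineP; exists (mu ^- 2).
Qed.

(** * Conic scalings *)

Variables z lam : 'I_d -> C.
Hypotheses (z_inj : injective z) (lam0 : forall i, lam i != 0).
Hypothesis cE : forall i j, Cm i j = lam i * lam j * (z i - z j) ^+ 2.

Lemma torus_criticalE b t :
  torus_critical b t <-> conic_critical z b (fun i => lam i * t i).
Proof.
have QE i : t i * (\sum_j Cm i j * t j) =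
    lam i * t i * conic_form z (fun i => lam i * t i) (z i).
  by rewrite !mulr_sumr; apply: eq_bigr => j _; rewrite cE; ring.
rewrite /torus_critical /conic_critical /conic_energy.
have -> : \sum_i t i * \sum_j Cm i j * t j = \sum_i lam i * t i *
   conic_form z (fun i => lam i * t i) (z i) by apply: eq_bigr => i _.
split=> -[h1 h2 h3]; split=> // i.
- by rewrite mulf_neq0.
- by rewrite -QE.
- by have := h1 i; rewrite mulf_eq0 negb_or => /andP[].
- by rewrite QE.
Qed.

(** The marginal map from edge weights to vertex weights is onto; this section
    of it is found among the [alpha * (b_i + b_j) + beta]. *)
Definition weights_with_marginal (b : 'I_d -> C) : 'rV[C]_N :=
  \row_k ((b (fst_of k) + b (snd_of k)) / (d%:R - 2) -
    (\sum_i b i) / ((d%:R - 1) * (d%:R - 2))).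

Lemma marginal_weights b i : marginal (weights_with_marginal b) i = b i.
Proof.
have d2 : d%:R - 2 != 0 :> C by rewrite subr_eq0 eqr_nat; lia.
have d1 : d%:R - 1 != 0 :> C by rewrite subr_eq0 (eqr_nat _ d 1); lia.
rewrite /marginal (bigD1 i) //= pair_mx_diag add0r.
transitivity (\sum_(j | j != i) ((b i + b j) / (d%:R - 2) -
    (\sum_i b i) / ((d%:R - 1) * (d%:R - 2)))).
  apply: eq_bigr => j; rewrite eq_sym => /edgeP[k [kE ->]]; rewrite mxE.
  by case: kE => -> //=; rewrite [b j + _]addrC.
rewrite sumrB -mulr_suml big_split /= !sumr_const !cardC1 !card_ord.
have -> : \sum_(j | j != i) b j = \sum_j b j - b i.
  by apply/esym/eqP; rewrite subr_eq addrC [\sum_j b j](bigD1 i).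
have nE (y : C) : y *+ d.-1 = (d%:R - 1) * y.
  have -> : d%:R = d.-1%:R + 1 :> C by rewrite natr1 prednK // (ltn_trans _ hd).
  by rewrite addrK mulr_natl.
rewrite !nE; field.
by rewrite d1 d2.
Qed.

(** The genericity polynomial of [conic_critical_count] is pulled back along the
    marginal map, and a further factor keeps the sum of the weights nonzero. *)
Theorem MLdeg_conic : is_MLdeg V 'C(d - 1, 2).
Proof.
have [g g0 gP] := conic_critical_count hd z_inj.
pose B i : {mpoly C[N]} := \sum_j pair_mx (fun k => 'X_k) i j.
have BE u i : (B i).@[fun k => u 0 k] = marginal u i.
  rewrite /B rmorph_sum; apply: eq_bigr => j _ /=.
  have [->|nij] := eqVneq i j; first by rewrite !pair_mx_diag meval0.
  exact: meval_Xm.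
pose G := (g * \sum_i 'X_i) \mPo [tuple B i | i < d].
have GE u : mevalr G u = g.@[marginal u] * (2 * \sum_k u 0 k).
  rewrite /mevalr /G comp_mpoly_meval mevalM -sum_marginal meval_sumX.
  by congr (_ * _); [apply: meval_eq | apply: eq_bigr] => i; rewrite tnth_mktuple BE.
exists G; split.
  have : g * \sum_(i < d) 'X_i != 0.
    rewrite mulf_neq0 //; apply: (@neq0_of_meval _ _ _ (fun=> 1)).
    by rewrite meval_sumX sumr_const card_ord pnatr_eq0; lia.
  move=> /meval_neq0[b]; apply: contraNneq => G0.
  have := GE (weights_with_marginal b); rewrite G0 /mevalr meval0 => /esym E.
  rewrite mevalM meval_sumX -[X in _ * X](eq_bigr _ (fun i _ => marginal_weights b i)).
  rewrite sum_marginal; apply/eqP; rewrite -[RHS]E; congr (_ * _).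
  by apply: meval_eq => i; rewrite marginal_weights.
move=> u; rewrite GE mulf_eq0 negb_or => /andP[gu].
rewrite mulf_eq0 negb_or => /andP[_ U0].
have [rep [repC repI repS]] := gP _ gu.
pose T k i := rep k i / lam i.
have lamT k i : lam i * T k i = rep k i by rewrite /T mulrC divfK.
have Tcrit k : (k < 'C(d - 1, 2))%N -> torus_critical (marginal u) (T k).
  move=> kN; apply/torus_criticalE.
  by rewrite (_ : (fun i => _) = rep k); [exact: repC | apply/funext].
have -> : critical_points V u =
    [set <[monomial_point c (T k)]>%VS | k in `I_('C(d - 1, 2))]%classic.
  apply/seteqP; split=> [_ [x xc <-]|_ [k kN <-]]; last first.
    exists (monomial_point c (T k)) => //.
    by apply/critical_pointP => //; exists (T k) => //; exact: Tcrit.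
  have [t tc xE] := (critical_pointP x U0).1 xc.
  have [k [mu [kN mu0 tE]]] := repS _ ((torus_criticalE _ _).1 tc).
  exists k => //; rewrite xE; apply/esym/monomial_point_line.
  - by case: tc.
  - by case: (Tcrit k kN).
  exists mu => // i; apply: (mulfI (lam0 i)).
  by rewrite tE -lamT; ring.
apply: inj_card_eq => k l; rewrite !inE => kN lN.
move/monomial_point_line => [||mu _ kl].
- by case: (Tcrit k kN).
- by case: (Tcrit l lN).
apply: (repI k l mu) => // i; rewrite -!lamT kl; ring.
Qed.
End Toric.

(** * Scalings of rank three *)

Lemma scaling_matrixE (R : realType) d (c : pairs d -> R[i]) i j :
  scaling_matrix c i j = pair_mx (fun k => c (pair_of k)) i j.
Proof.
rewrite mxE; case: insubP => [ij ijP ijE|nij].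
  have := pair_mx_pair (fun k => c (pair_of k)) (enum_rank ij).
  by rewrite /pair_of enum_rankK ijE.
case: insubP => [ij ijP ijE|nji].
  have := pair_mx_pair (fun k => c (pair_of k)) (enum_rank ij).
  by rewrite /pair_of enum_rankK ijE pair_mxC.
have -> : i = j by apply: val_inj => /=; move: nij nji => /=; lia.
by rewrite pair_mx_diag.
Qed.

Theorem theorem1p5 (R : realType) (d : nat) (hd : (3 <= d)%N) :
  (forall c : pairs d -> R[i],
     is_scaling c -> \rank (scaling_matrix c) = 3%N ->
     is_MLdeg (scaled_toric_variety c) 'C(d - 1, 2)%N) /\
  (exists c : pairs d -> R[i],
     is_scaling c /\ is_MLdeg (scaled_toric_variety c) 'C(d - 1, 2)%N).
Proof.
split=> [c c0 rk|].
  have [i0 [i1 [i2 [n01 n02 n12]]]] := three_nodes hd.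
  have [|||z [lam [z_inj lam0 CE]]] := rank3_conic _ _ _ rk n01 n02 n12.
  - by move=> i j; rewrite !scaling_matrixE pair_mxC.
  - by move=> i; rewrite scaling_matrixE pair_mx_diag.
  - by move=> i j nij; rewrite scaling_matrixE scaling_mx_neq0.
  apply: (MLdeg_conic hd c0 z_inj lam0) => i j.
  by rewrite -scaling_matrixE CE.
pose c (ij : pairs d) : R[i] := ((val ij).1%:R - (val ij).2%:R) ^+ 2.
have nat_inj : injective (fun i : 'I_d => i%:R : R[i]).
  by move=> i j /eqP; rewrite eqr_nat => /eqP/val_inj.
have c0 : is_scaling c.
  move=> ij; rewrite expf_neq0 // subr_eq0 (inj_eq nat_inj).
  by apply/eqP => e; have := valP ij; rewrite e ltnn.
exists c; split=> //.
apply: (MLdeg_conic hd c0 nat_inj (lam := fun=> 1)) => [i|i j].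
  exact: oner_neq0.
have [->|nij] := eqVneq i j; first by rewrite pair_mx_diag subrr expr0n mulr0.
have [k [kE ->]] := edgeP nij; rewrite /c; case: kE => -> /=; ring.
Qed.
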